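(* Let $x$ be large and $y\ge x^{3\beta/2}\log^5 x$. Then for $\beta=1,2$ one has \[ C_{1,\beta}(x,y)=y-\frac{x^{1+\beta}}{2(1+\beta)\zeta(1+\beta)}+O\!\left(x^{\beta}y^{1/3}\log^4 y+x^{2\beta+1}y^{-2/3}+x^{\beta+1}y^{-1/3}\right), \] and for every integer $\beta\ge 3$ one has \[ C_{1,\beta}(x,y)=y+O\!\left(x^{\beta}y^{1/3}\log^4 y\right). \]
   Context: For a positive integer $\beta$ and positive integers $q,n$, Cohen's generalized Ramanujan sum is \[ c_{q,\beta}(n):=\sum_{\substack{0\le h<q^{\beta}\\ (h,q^{\beta})_{\beta}=1}} e^{2\pi i n h/q^{\beta}}, \] where $(h,q^\beta)_\beta=1$ means that $h$ and $q^\beta$ have no common divisor which is a $\beta$-th power other than $1$. Define \[ C_{1,\beta}(x,y):=\sum_{n\le y}\sum_{q\le x}c_{q,\beta}(n). \] $\zeta$ is the Riemann zeta function. *)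

(* Defs.v *)
From HB Require Import structures.
From mathcomp Require Import all_boot all_order all_algebra.
From mathcomp Require Import all_classical all_reals all_analysis.
From mathcomp Require Export complex.

Set Implicit Arguments.
Unset Strict Implicit.
Unset Printing Implicit Defensive.

Import Order.TTheory GRing.Theory Num.Theory.
Import numFieldNormedType.Exports.
Local Open Scope ring_scope.
Local Open Scope complex_scope.

(* (h, m)_b = 1: the only b-th power dividing both h and m is 1.  Since every
   b-th power divides 0, h = 0 qualifies only if no b-th power other than 1
   divides m. *)
Definition power_coprime (b h m : nat) : Prop :=
  forall d : nat, (d ^ b %| h)%N -> (d ^ b %| m)%N -> (d ^ b)%N = 1%N.

(* exp (i t) *)
Definition expi (R : realType) (t : R) : R[i] := cos t +i* sin t.

Definition cohen_sum (R : realType) (b q n : nat) : R[i] :=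
  \sum_(0 <= h < q ^ b | `[< power_coprime b h (q ^ b) >])
    expi (2 * pi * n%:R * h%:R / (q ^ b)%:R).

Definition C1sum (R : realType) (b : nat) (x y : R) : R[i] :=
  \sum_(1 <= n < (Num.truncn y).+1) \sum_(1 <= q < (Num.truncn x).+1)
    cohen_sum R b q n.

(* The Riemann zeta function on the half-line s > 1, where it is the sum of its
   Dirichlet series; junk value elsewhere. *)
Definition zeta (R : realType) (s : R) : R :=
  limn (series (fun k : nat => (k.+1%:R `^ (- s) : R))).

(* Main.v *)
(** Moebius inversion gives [c_{q,b}(n) = sum_{e | q} mu(e) (q/e)^b [(q/e)^b | n]],
    hence [C1 = y - sum_{k <= x} mu(k) sum_{d <= x/k} d^b {y/d^b}].  For [b >= 2] the
    hypothesis forces [x <= y^(1/3)] and bounding the fractional parts by 1 is enough.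

    For [b = 1] write [{t} = 1/2 + psi t].  The term 1/2 yields [x^2/(4 zeta(2))], because
    [sum_{k <= x} mu(k)/k^2 = 1/zeta(2) + O(log x / x)].  What remains is Voronoi's
    bound for [sum_{n <= m} n psi(y/n)], obtained in an elementary way: for [n] in a
    dyadic interval [D, 2D], approximate the slope [y/n^2] by [p/q] with
    [q <= T = D y^(-1/3)].  On the block [n, n + q) the points [y/(n+j)] are close to the
    shifted multiples of [p/q], which are equidistributed modulo 1, so that the block
    contributes O(1) to the sum of [psi].  Blocks are chosen greedily, and they
    are counted by the fractions [p/q] that they use. *)

Require Import Defs.
From mathcomp Require Import all_boot all_order all_algebra.
From mathcomp Require Import all_classical all_reals all_analysis.
From mathcomp Require Import ring lra zify.

Import Order.TTheory GRing.Theory Num.Theory.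
Import numFieldNormedType.Exports.
Local Open Scope ring_scope.
Local Open Scope complex_scope.

(** * The Moebius function and Cohen's sums *)

(** Substitution [q = e d], in a form usable for rewriting. In the induction on [N], the quotient
    [N %/ e] grows by one exactly when a new multiple of [e] is reached. *)
Lemma sum_multiples (V : nmodType) (e N : nat) (H : nat -> V) : (0 < e)%N ->
  \sum_(1 <= q < N.+1 | (e %| q)%N) H (q %/ e)%N = \sum_(1 <= d < (N %/ e).+1) H d.
Proof.
move=> e0; elim: N => [|N IHN]; first by rewrite div0n !big_geq.
rewrite big_mkcond big_nat_recr // -big_mkcond IHN divnS //.
case: ifP => [dvd|_]; last by rewrite add0n [LHS]Monoid.mulm1.
by rewrite dvd add1n [RHS]big_nat_recr.
Qed.

(** With a common bound [X], the divisor sums of all [q <= X] run over one range, which can be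
    exchanged with the sum over [q]. *)
Lemma sum_divisors (V : nmodType) (q X : nat) (F : nat -> V) : (0 < q <= X)%N ->
  \sum_(e <- divisors q) F e = \sum_(1 <= e < X.+1 | (e %| q)%N) F e.
Proof.
move=> /andP[q0 qX]; rewrite -[RHS]big_filter; apply: perm_big; apply: uniq_perm.
- exact: divisors_uniq.
- by rewrite filter_uniq // iota_uniq.
move=> e; rewrite mem_filter mem_index_iota -dvdn_divisors //.
case: (boolP (e %| q)%N) => //= dvd; rewrite (dvdn_gt0 q0 dvd) ltnS /=.
by rewrite (leq_trans (dvdn_leq q0 dvd) qX).
Qed.

(** Both sides run over the pairs [(e, d)] with [e d <= X]. *)
Lemma sum_hyperbola (V : nmodType) (X : nat) (F : nat -> nat -> V) :
  \sum_(1 <= q < X.+1) \sum_(e <- divisors q) F e (q %/ e)%N =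
  \sum_(1 <= e < X.+1) \sum_(1 <= d < (X %/ e).+1) F e d.
Proof.
transitivity (\sum_(1 <= q < X.+1) \sum_(1 <= e < X.+1 | (e %| q)%N) F e (q %/ e)%N).
  by apply: eq_big_nat => q; rewrite ltnS => hq; apply: sum_divisors.
rewrite (exchange_big_dep xpredT) //=.
by apply: eq_big_nat => e /andP[e0 _]; rewrite sum_multiples.
Qed.

(** At 0 the list of primes is empty and the value is 1; the sums below only meet positive
    arguments. *)
Definition mobius (n : nat) : int :=
  \prod_(p <- primes n) (if (p ^ 2 %| n)%N then 0 else -1).

Lemma mobius1 : mobius 1 = 1.
Proof. by rewrite /mobius big_nil. Qed.

Lemma norm_mobius (n : nat) : `|mobius n| <= 1.
Proof.
rewrite /mobius; apply: (big_ind (fun z : int => `|z| <= 1)) => //.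
- by move=> a b ha hb; rewrite normrM mulr_ile1.
- by move=> p _; case: ifP.
Qed.

Lemma mobius_prime_dvd (p e : nat) : prime p -> (0 < e)%N -> (p %| e)%N ->
  mobius (p * e) = 0.
Proof.
move=> pp e0 pe; rewrite /mobius; apply/eqP; rewrite prodf_seq_eq0.
apply/hasP; exists p; first by rewrite mem_primes pp muln_gt0 prime_gt0 // e0 dvdn_mulr.
by rewrite /= -mulnn dvdn_pmul2l ?prime_gt0 // pe eqxx.
Qed.

Lemma mobius_prime_ndvd (p e : nat) : prime p -> (0 < e)%N -> ~~ (p %| e)%N ->
  mobius (p * e) = - mobius e.
Proof.
move=> pp e0 pe; rewrite /mobius.
have pm : perm_eq (primes (p * e)) (p :: primes e).
  apply: uniq_perm; first exact: primes_uniq.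
    by rewrite /= primes_uniq mem_primes (negbTE pe) !andbF.
  by move=> r; rewrite primesM ?(prime_gt0 pp) // (primes_prime pp) !inE.
rewrite (perm_big _ pm) big_cons /= -mulnn dvdn_pmul2l ?prime_gt0 // (negbTE pe).
rewrite mulN1r; congr (- _); apply: eq_big_seq => r; rewrite mem_primes => /and3P[pr _ re].
rewrite Gauss_dvdr // coprime_pexpl // prime_coprime //.
by apply: contra pe; rewrite dvdn_prime2 // => /eqP <-.
Qed.

(** Fix a prime [p] dividing [n]. The divisors [p e] cancel against the divisors [e] prime to [p],
    since [mobius (p * e)] is [- mobius e] when [p] does not divide [e], and 0 otherwise. *)
Lemma sum_mobius (n : nat) : (0 < n)%N ->
  \sum_(e <- divisors n) mobius e = (n == 1%N)%:R.
Proof.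
move=> n0; case: (ltngtP n 1) => [|n1|->]; first by case: n n0.
  set p := pdiv n; have pp : prime p by apply: pdiv_prime.
  have pn : (p %| n)%N by apply: pdiv_dvd.
  rewrite (sum_divisors _ n n) ?n0 ?leqnn //.
  rewrite (bigID (fun e => (p %| e)%N)) /=.
  have -> : \sum_(1 <= i < n.+1 | (i %| n)%N && (p %| i)%N) mobius i =
      \sum_(1 <= i < n.+1 | (p %| i)%N) (if (p * (i %/ p) %| n)%N then mobius (p * (i %/ p)) else 0).
    rewrite [RHS]big_mkcond [LHS]big_mkcond; apply: eq_bigr => i _.
    by case: (boolP (p %| i)%N) => pi; rewrite ?andbF // andbT mulnC divnK.
  rewrite (@sum_multiples _ p n (fun i => if (p * i %| n)%N then mobius (p * i) else 0)) ?prime_gt0 //.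
  rewrite [X in X + _](_ : _ = - \sum_(1 <= i < n.+1 | (i %| n)%N && ~~ (p %| i)%N) mobius i) ?addNr //.
  rewrite -sumrN.
  have le : (n %/ p <= n)%N by apply: leq_div.
  rewrite [RHS](@big_cat_nat _ _ _ (n %/ p).+1) //.
  rewrite [X in _ = _ + X]big_nat_cond [X in _ = _ + X]big1 ?addr0; last first.
    move=> i /andP[/andP[i1 i2] /andP[dn ndp]].
    (* A divisor [i] of [n] prime to [p] satisfies [p i | n], hence cannot exceed [n %/ p]. *)
    have : (p * i %| n)%N by rewrite Gauss_dvd ?pn // prime_coprime.
    move/(dvdn_leq n0); rewrite leqNgt => /negP[]; move: i1; rewrite ltn_divLR ?prime_gt0 //.
    by rewrite mulnC.
  rewrite [RHS]big_mkcond; apply: eq_big_nat => i /andP[i0 _].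
  case: (boolP (p %| i)%N) => pi; rewrite ?andbF ?andbT.
    by rewrite mobius_prime_dvd // if_same.
  by rewrite mobius_prime_ndvd // Gauss_dvd ?pn // prime_coprime.
by rewrite /= big_seq1 mobius1.
Qed.

(** Dividing by the [b]-th power of the gcd leaves [e'] and [f'] coprime, and coprime powers that
    divide a number divide it jointly. *)
Lemma dvdn_exp_lcm (b e f h : nat) :
  (e ^ b %| h)%N -> (f ^ b %| h)%N -> (lcmn e f ^ b %| h)%N.
Proof.
case: (posnP e) => [->|e0]; first by rewrite lcm0n.
move=> eh fh; have g0 : (0 < gcdn e f)%N by rewrite gcdn_gt0 e0.
set g := gcdn e f in g0.
have [e' Ee] : exists e', e = (e' * g)%N by exists (e %/ g)%N; rewrite divnK // dvdn_gcdl.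
have [f' Ef] : exists f', f = (f' * g)%N by exists (f %/ g)%N; rewrite divnK // dvdn_gcdr.
have cop : coprime e' f'.
  by rewrite /coprime -(eqn_pmul2r g0) muln_gcdl -Ee -Ef mul1n.
have -> : lcmn e f = (g * (e' * f'))%N.
  apply/eqP; rewrite -(eqn_pmul2r g0) muln_lcm_gcd {1}Ee {1}Ef; apply/eqP; ring.
have [h' Eh] : exists h', h = (h' * g ^ b)%N.
  exists (h %/ g ^ b)%N; rewrite divnK //; apply: dvdn_trans eh.
  by rewrite Ee expnMn dvdn_mull.
move: eh fh; rewrite Eh Ee Ef !expnMn !dvdn_pmul2r ?expn_gt0 ?g0 // => eh fh.
by rewrite mulnC dvdn_pmul2r ?expn_gt0 ?g0 // Gauss_dvd ?eh // coprimeXl // coprimeXr.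
Qed.

(** The [e] in the sum are exactly the divisors of one number [G], so that the sum detects
    [G = 1]. *)
Lemma sum_mobius_power_coprime (b q h : nat) : (0 < b)%N -> (0 < q)%N ->
  \sum_(e <- divisors q | (e ^ b %| h)%N) mobius e =
  (`[< power_coprime b h (q ^ b) >])%:R.
Proof.
move=> b0 q0.
pose P e := (e %| q)%N && (e ^ b %| h)%N.
have exP : exists e, P e by exists 1%N; rewrite /P dvd1n exp1n dvd1n.
have ubP e : P e -> (e <= q)%N by case/andP => /(dvdn_leq q0).
case: (ex_maxnP exP ubP) => G /andP[Gq Gh] maxG.
(* Maximality of [G] suffices: the lcm of [e] and [G] satisfies [P] again, so it equals [G]. *)
have PG e : P e = (e %| G)%N.
  apply/idP/idP => [Pe|eG]; last first.
    rewrite /P (dvdn_trans eG Gq) (dvdn_trans _ Gh) //.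
    exact: dvdn_exp2r.
  case/andP: (Pe) => eq_ eh.
  have /maxG : P (lcmn e G) by rewrite /P dvdn_lcm eq_ Gq /= dvdn_exp_lcm.
  have G0 : (0 < G)%N by apply: dvdn_gt0 Gq.
  have e0 : (0 < e)%N by apply: dvdn_gt0 eq_.
  move=> le; have : (lcmn e G == G)%N.
    by rewrite eqn_leq le /= dvdn_leq ?lcmn_gt0 ?e0 // dvdn_lcmr.
  by move/eqP <-; apply: dvdn_lcml.
have G0 : (0 < G)%N by apply: dvdn_gt0 Gq.
transitivity (\sum_(e <- divisors G) mobius e).
  rewrite -[LHS]big_filter; apply: perm_big; apply: uniq_perm.
  - by rewrite filter_uniq // divisors_uniq.
  - exact: divisors_uniq.
  by move=> e; rewrite mem_filter -!dvdn_divisors // -PG /P andbC.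
rewrite sum_mobius //; congr (_%:R); congr nat_of_bool.
apply/eqP/asboolP => [G1 d dh dq|cop].
  have : P d by rewrite /P dh andbT; move: dq; rewrite dvdn_pexp2r.
  by rewrite PG G1 dvdn1 => /eqP ->; rewrite exp1n.
have := cop G Gh; rewrite dvdn_pexp2r // => /(_ Gq) /eqP.
by rewrite -{1}(exp1n b) eqn_exp2r // => /eqP.
Qed.

(** The substitution over a full period starting at 0; the term [h = 0] is split off to reuse
    [sum_multiples]. *)
Lemma sum_multiples0 (V : nmodType) (e D : nat) (H : nat -> V) : (0 < e)%N -> (0 < D)%N ->
  \sum_(0 <= h < e * D | (e %| h)%N) H (h %/ e)%N = \sum_(0 <= k < D) H k.
Proof.
move=> e0 D0; have eD0 : (0 < e * D)%N by rewrite muln_gt0 e0.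
rewrite [LHS]big_mkcond (big_ltn eD0) (big_ltn D0) dvdn0 div0n.
congr (_ + _); rewrite -big_mkcond.
have -> : (e * D)%N = (e * D).-1.+1 by rewrite prednK // muln_gt0 e0.
rewrite sum_multiples //; congr (bigop.body _ (index_iota _ _) _).
case: D D0 eD0 => // D _ _.
(* Euclidean division of the last index: quotient [D], remainder [e.-1]. *)
have -> : (e * D.+1).-1 = (D * e + e.-1)%N by rewrite mulnS mulnC; lia.
by rewrite divnMDl // divn_small ?addn0 // prednK.
Qed.

(** * Complete exponential sums *)

Lemma expiD (R : realType) (s t : R) : expi (s + t) = expi s * expi t.
Proof. by rewrite /expi cosD sinD; apply/eqP; rewrite eq_complex /= addrC eqxx eq_sym addrC mulrC eqxx. Qed.

Lemma expi_natmul (R : realType) (t : R) (h : nat) : expi (t * h%:R) = expi t ^+ h.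
Proof.
elim: h => [|h IHh]; first by rewrite mulr0 /expi cos0 sin0.
by rewrite exprS -IHh -expiD -natr1 mulrDr mulr1 addrC.
Qed.

Lemma expi_2pi (R : realType) : expi (2 * pi : R) = 1.
Proof. by rewrite mulrC mulr_natr /expi cos2pi sin2pi. Qed.

Lemma expi_neq1 (R : realType) (t : R) : 0 < t < 2 * pi -> expi t != 1.
Proof.
move=> /andP[t0 t2]; have : 0 < sin (t / 2) by apply: sin_gt0_pi; lra.
move=> s0; rewrite eq_complex negb_and /=; apply/orP; left.
have -> : t = (t / 2) *+ 2 by rewrite -mulr_natr; field.
rewrite cos_mulr2n; apply/eqP => h; have := cos2Dsin2 (t / 2); nra.
Qed.

Lemma sum_expi (R : realType) (N n : nat) : (0 < N)%N ->
  \sum_(0 <= h < N) expi (2 * pi * n%:R * h%:R / N%:R : R) =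
  (if (N %| n)%N then N else 0%N)%:R.
Proof.
move=> N0; have N0' : N%:R != 0 :> R by rewrite pnatr_eq0 -lt0n.
pose z : R[i] := expi (2 * pi * n%:R / N%:R).
under eq_bigr => h _.
  rewrite (_ : _ / _ = (2 * pi * n%:R / N%:R) * h%:R); last by field.
  rewrite expi_natmul; over.
rewrite -/z big_mkord.
(* Reducing [n] modulo [N] brings the angle into [[0, 2 pi)], where [expi_neq1] applies unless the
   remainder is 0. *)
have zE : z = expi (2 * pi * (n %% N)%:R / N%:R).
  rewrite /z {1}(divn_eq n N) natrD natrM.
  rewrite (_ : _ / _ = 2 * pi * (n %/ N)%:R + 2 * pi * (n %% N)%:R / N%:R); last by field.
  by rewrite expiD expi_natmul expi_2pi expr1n mul1r.
case: ifP => [|Nn].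
  rewrite /dvdn => /eqP n0; have z1 : z = 1.
    by rewrite zE n0 mulr0 mul0r /expi cos0 sin0.
  by under eq_bigr do rewrite z1 expr1n; rewrite sumr_const card_ord.
have zN : z ^+ N = 1.
  rewrite -expi_natmul (_ : _ * _ = 2 * pi * n%:R); last by field.
  by rewrite expi_natmul expi_2pi expr1n.
have z1 : z - 1 != 0.
  have Npos : 0 < N%:R :> R by rewrite ltr0n.
  have ppos : 0 < pi :> R by exact: pi_gt0.
  rewrite subr_eq0 zE; apply: expi_neq1; rewrite divr_gt0 ?mulr_gt0 ?ltr0n //=; last first.
    by rewrite lt0n; move: Nn; rewrite /dvdn => ->.
  rewrite ltr_pdivrMr // ltr_pM2l ?mulr_gt0 // ltr_nat ltn_pmod //.
by apply: (mulfI z1); rewrite -subrX1 zN subrr mulr0.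
Qed.

(** The coprimality condition is expanded by [sum_mobius_power_coprime]. For fixed [e] the remaining
    [h] are the multiples of [e ^ b], and they form a complete exponential sum modulo
    [(q %/ e) ^ b]. *)
Lemma cohen_sum_mobius (R : realType) (b q n : nat) : (0 < b)%N -> (0 < q)%N ->
  cohen_sum R b q n =
  \sum_(e <- divisors q) (mobius e)%:~R *
    (if ((q %/ e) ^ b %| n)%N then ((q %/ e) ^ b)%N else 0%N)%:R.
Proof.
move=> b0 q0; rewrite /cohen_sum big_mkcond.
transitivity (\sum_(0 <= h < q ^ b) \sum_(e <- divisors q | (e ^ b %| h)%N)
   (mobius e)%:~R * expi (2 * pi * n%:R * h%:R / (q ^ b)%:R : R)).
  apply: eq_bigr => h _; rewrite -mulr_suml -rmorph_sum sum_mobius_power_coprime //.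
  by case: asboolP => _; rewrite ?mul1r ?mul0r.
rewrite (exchange_big_dep xpredT) //= big_seq [RHS]big_seq; apply: eq_bigr => e.
rewrite -dvdn_divisors // => eq_.
have e0 : (0 < e)%N by apply: dvdn_gt0 eq_.
have qe0 : (0 < q %/ e)%N by rewrite divn_gt0 // dvdn_leq.
rewrite -mulr_sumr; congr (_ * _); rewrite -sum_expi ?expn_gt0 ?qe0 //.
have qE : (q ^ b)%N = (e ^ b * (q %/ e) ^ b)%N by rewrite -expnMn mulnC divnK.
pose H k : R[i] := expi (2 * pi * n%:R * k%:R / ((q %/ e) ^ b)%:R).
rewrite qE -(@sum_multiples0 _ (e ^ b) _ H) ?expn_gt0 ?e0 ?qe0 //.
apply: eq_bigr => h /divnK hE; rewrite /H -{1}hE; congr expi.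
rewrite !natrM; field.
by rewrite !pnatr_eq0 -!lt0n !expn_gt0 e0 qe0.
Qed.

(** Summing over [n] first counts the multiples of [(q %/ e) ^ b] up to [y]; then [sum_hyperbola]
    regroups the pairs [(e, q %/ e)]. *)
Lemma C1sum_mobius (R : realType) (b : nat) (x y : R) : (0 < b)%N ->
  C1sum b x y = (\sum_(1 <= k < (Num.truncn x).+1) (mobius k)%:~R *
    \sum_(1 <= d < (Num.truncn x %/ k).+1)
      (d ^ b)%:R * (Num.truncn y %/ d ^ b)%:R)%:C.
Proof.
move=> b0; rewrite /C1sum exchange_big /=.
set X := Num.truncn x; set Y := Num.truncn y.
transitivity (\sum_(1 <= q < X.+1) \sum_(e <- divisors q)
   (((mobius e)%:~R * (((q %/ e) ^ b)%:R * (Y %/ (q %/ e) ^ b)%:R : R))%:C)).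
  apply: eq_big_nat => q /andP[q0 _].
  under eq_bigr do rewrite cohen_sum_mobius //.
  rewrite exchange_big /= big_seq [RHS]big_seq; apply: eq_bigr => e.
  rewrite -dvdn_divisors // => eq_.
  have e0 : (0 < e)%N by apply: dvdn_gt0 eq_.
  have qe0 : (0 < (q %/ e) ^ b)%N by rewrite expn_gt0 divn_gt0 // dvdn_leq.
  rewrite -mulr_sumr -natrM -[RHS]/(real_complex R _) rmorphM /= rmorph_int rmorph_nat.
  congr (_ * _); rewrite -natr_sum; congr (_%:R).
  rewrite -big_mkcond /= (@sum_multiples _ ((q %/ e) ^ b) Y (fun=> ((q %/ e) ^ b)%N)) //.
  by rewrite sum_nat_const_nat subn1 mulnC.
rewrite (@sum_hyperbola _ X (fun e d => (((mobius e)%:~R * ((d ^ b)%:R * (Y %/ d ^ b)%:R : R))%:C))).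
rewrite -[RHS]/(real_complex R _) rmorph_sum; apply: eq_bigr => k _.
by rewrite mulr_sumr rmorph_sum.
Qed.

(** * The sawtooth function on blocks *)

(** The sawtooth, centred so that its sums over equidistributed points cancel; its value at an
    integer is -1/2. *)
Definition psi (R : realType) (t : R) : R := t - (Num.floor t)%:~R - 2^-1.
Arguments psi {R} t.

Lemma psi_bound (R : realType) (t : R) : `|psi t| <= 2^-1.
Proof.
have := floor_le t; have := floorD1_gt t; rewrite /psi intrD => h1 h2.
rewrite ler_norml; apply/andP; split; lra.
Qed.

(** All jumps of [psi] go down, so its growth is controlled by the slope 1. *)
Lemma psi_le (R : realType) (s t : R) : s <= t -> psi t <= psi s + (t - s).
Proof.
move=> st; have : (Num.floor s)%:~R <= (Num.floor t)%:~R :> R by rewrite ler_int le_floor.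
rewrite /psi; lra.
Qed.

(** The one-sided bound [psi_le] controls both sides once the argument is shifted by [E]. The shift
    is common to all terms of a block, so [sum_psi_rational] still applies after it. *)
Lemma psi_perturb (R : realType) (t e E : R) : `|e| <= E ->
  psi (t + E) - 2 * E <= psi (t + e) <= psi (t - E) + 2 * E.
Proof.
rewrite ler_norml => /andP[h1 h2]; apply/andP; split.
  by have := @psi_le R (t + e) (t + E); rewrite lerD2l => /(_ h2); lra.
by have := @psi_le R (t - E) (t + e); rewrite lerD2l => /(_ h1); lra.
Qed.

Lemma psi_unique (R : realType) (t r : R) (z : int) : 0 <= r < 1 -> t = z%:~R + r ->
  psi t = r - 2^-1.
Proof.
move=> /andP[r0 r1] ->; rewrite /psi.
have -> : Num.floor (z%:~R + r) = z.
  by apply: floor_def; rewrite intrD; apply/andP; split; lra.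
ring.
Qed.

(* The multiples of p/q run through all residues modulo 1/q, whence only the
   fractional part of q c survives. *)
Lemma sum_psi_rational (R : realType) (p q : nat) (c : R) : (0 < q)%N -> coprime p q ->
  `|\sum_(0 <= j < q) psi (c - j%:R * p%:R / q%:R)| <= 2^-1.
Proof.
move=> q0 cpq; have q0' : 0 < q%:R :> R by rewrite ltr0n.
pose a := Num.floor (q%:R * c); pose th := q%:R * c - a%:~R.
have th0 : 0 <= th by have := floor_le (q%:R * c); rewrite /th; lra.
have th1 : th < 1 by have := floorD1_gt (q%:R * c); rewrite /th intrD; lra.
have qz : (q : int) != 0 by rewrite -lt0n in q0 *.
(* [c - j p / q] is an integer plus [(r j + th) / q], where [r j] is the residue of [a - j p] modulo
   [q]. *)
pose r (j : nat) : nat := `|((a - (j * p)%N%:Z) %% q)%Z|%N.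
have rE j : (r j)%:Z = ((a - (j * p)%N%:Z) %% q)%Z.
  by rewrite /r gez0_abs // modz_ge0.
have rq j : (r j < q)%N by rewrite -ltz_nat rE ltz_pmod.
have psiE j : psi (c - j%:R * p%:R / q%:R) = ((r j)%:R + th) / q%:R - 2^-1.
  apply: (@psi_unique _ _ _ ((a - (j * p)%N%:Z) %/ q)%Z).
    apply/andP; split; first by apply: divr_ge0; [apply: addr_ge0|apply: ltW].
    rewrite ltr_pdivrMr // mul1r.
    have : (r j)%:R + 1 <= q%:R :> R by rewrite natr1 ler_nat.
    lra.
  have hd : a%:~R - j%:R * p%:R = ((a - (j * p)%N%:Z) %/ q)%Z%:~R * q%:R + (r j)%:R :> R.
    have := divz_eq (a - (j * p)%N%:Z) q; rewrite -rE => /(congr1 (fun z : int => z%:~R : R)).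
    by rewrite intrB intrD intrM -!pmulrn natrM.
  have -> : c = (a%:~R + th) / q%:R by rewrite /th; field; rewrite gt_eqF.
  have -> : ((a - (j * p)%N%:Z) %/ q)%Z%:~R = (a%:~R - j%:R * p%:R - (r j)%:R) / q%:R :> R.
    by rewrite hd; field; rewrite gt_eqF.
  by field; rewrite gt_eqF.
pose f (j : 'I_q) : 'I_q := Ordinal (rq j).
have f_inj : injective f.
  move=> i j /(congr1 val) /= /(congr1 Posz); rewrite !rE => /eqP.
  rewrite eqz_mod_dvd.
  have -> : a - (i * p)%N%:Z - (a - (j * p)%N%:Z) = (j * p)%N%:Z - (i * p)%N%:Z by ring.
  move=> h; apply: val_inj => /=.
  wlog ij : i j h / (i <= j)%N.
    move=> H; case/orP: (leq_total i j) => ij; first exact: H.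
    by apply/esym/H => //; move: h; rewrite !dvdzE distnC.
  move: h; rewrite subzn ?leq_mul2r ?ij ?orbT // -mulnBl dvdzE !absz_nat.
  rewrite Gauss_dvdl 1?coprime_sym // => h.
  apply/eqP; rewrite eqn_leq ij /= -subn_eq0; case: posnP => // ji0.
  have := dvdn_leq ji0 h; rewrite leqNgt => /negP[]; apply: leq_ltn_trans (ltn_ord j).
  exact: leq_subr.
(* The residues [r j] are a permutation of [0, ..., q - 1], so the sum is
   [(q - 1) / 2 + th - q / 2]. *)
have -> : \sum_(0 <= j < q) psi (c - j%:R * p%:R / q%:R) = th - 2^-1.
  rewrite big_mkord; under eq_bigr do rewrite psiE.
  rewrite sumrB sumr_const card_ord -mulr_suml big_split /= sumr_const card_ord.
  rewrite -(reindex_inj (P := xpredT) (F := fun i : 'I_q => (val i)%:R : R) f_inj) /=.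
  have -> : \sum_(i < q) (i%:R : R) = q%:R * (q%:R - 1) / 2.
    elim: (q) => [|k IHk]; first by rewrite big_ord0 mul0r mul0r.
    by rewrite big_ord_recr /= IHk -natr1; field.
  by rewrite -[th *+ q]mulr_natl -[2^-1 *+ q]mulr_natl; field; rewrite gt_eqF.
by rewrite ler_norml; apply/andP; split; lra.
Qed.

(** Pigeonhole: among the fractional parts of [0, a, ..., T a], two lie in the same of [T] intervals
    of length [1 / T]. The fraction found is then put in lowest terms, which only relaxes the
    bound. *)
Lemma dirichlet_approximation (R : realType) (a : R) (T : nat) : 0 <= a -> (0 < T)%N ->
  exists p q : nat, [/\ (0 < q <= T)%N, coprime p q &
    `|a - p%:R / q%:R| <= (q%:R * T%:R)^-1].
Proof.
move=> a0 T0; have T0' : 0 < T%:R :> R by rewrite ltr0n.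
pose fr (i : nat) : R := i%:R * a - (Num.floor (i%:R * a))%:~R.
have fr0 i : 0 <= fr i by rewrite subr_ge0 floor_le.
have fr1 i : fr i < 1 by have := floorD1_gt (i%:R * a); rewrite /fr intrD; lra.
pose b i := Num.truncn (T%:R * fr i).
have bP i : (b i)%:R <= T%:R * fr i < (b i)%:R + 1.
  by have := @truncn_itv R (T%:R * fr i); rewrite mulr_ge0 ?ler0n ?fr0 // -natr1 => /(_ isT).
have bT i : (b i < T)%N.
  rewrite -(ltr_nat R); case/andP: (bP i) => h _; apply: le_lt_trans h _.
  by rewrite -[ltRHS]mulr1 ltr_pM2l.
pose f (i : 'I_T.+1) : 'I_T := Ordinal (bT i).
have : ~~ injectiveb f.
  by apply/negP => /injectiveP /leq_card; rewrite !card_ord ltnn.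
case/injectivePn => i [j ij /(congr1 val) /= bij].
wlog lij : i j ij bij / (i < j)%N.
  move=> H; case: (ltngtP i j) => [|h|/val_inj e]; first exact: H.
    by apply: (H j i) => //; rewrite eq_sym.
  by rewrite e eqxx in ij.
pose q := (j - i)%N; have q0 : (0 < q)%N by rewrite subn_gt0.
have qT : (q <= T)%N by rewrite leq_subLR (leq_trans _ (leq_addl _ _)) // -ltnS.
pose P := Num.floor (j%:R * a) - Num.floor (i%:R * a).
have key : `|q%:R * a - P%:~R| < T%:R^-1.
  have -> : q%:R * a - P%:~R = fr j - fr i.
    by rewrite /q /P /fr natrB ?(ltnW lij) // intrB; ring.
  rewrite -(ltr_pM2l T0') divff ?gt_eqF // -[X in X * _](gtr0_norm T0') -normrM mulrBr.
  move: (bP i) (bP j); rewrite bij => /andP[? ?] /andP[? ?].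
  by rewrite ltr_norml; apply/andP; split; lra.
(* [P > -1], because [q a >= 0] and [|q a - P| < 1]. *)
have P0 : 0 <= P.
  rewrite -ltzD1 -(ltr_int R) intrD.
  have : T%:R^-1 <= 1 :> R by rewrite invf_le1 // ler1n.
  have : 0 <= q%:R * a by rewrite mulr_ge0.
  move: key; rewrite ltr_norml => /andP[? ?]; lra.
have PE : P%:~R = `|P|%N%:R :> R by rewrite -[in LHS](gez0_abs P0).
pose g := gcdn `|P| q; have g0 : (0 < g)%N by rewrite gcdn_gt0 q0 orbT.
have [p' Ep] : exists p', `|P|%N = (p' * g)%N by exists (`|P| %/ g)%N; rewrite divnK // dvdn_gcdl.
have [q' Eq] : exists q', q = (q' * g)%N by exists (q %/ g)%N; rewrite divnK // dvdn_gcdr.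
have q'0 : (0 < q')%N by move: q0; rewrite Eq muln_gt0 => /andP[].
have q'q : (q' <= q)%N by rewrite Eq leq_pmulr.
exists p', q'; split.
- by rewrite q'0 (leq_trans q'q).
- by rewrite /coprime -(eqn_pmul2r g0) muln_gcdl -Ep -Eq mul1n.
have q0' : 0 < q%:R :> R by rewrite ltr0n.
have q'0' : 0 < q'%:R :> R by rewrite ltr0n.
have g0' : 0 < g%:R :> R by rewrite ltr0n.
have -> : p'%:R / q'%:R = P%:~R / q%:R :> R.
  by rewrite PE Ep Eq !natrM; field; rewrite !gt_eqF.
have -> : a - P%:~R / q%:R = (q%:R * a - P%:~R) / q%:R by field; rewrite gt_eqF.
rewrite normrM normfV (gtr0_norm q0') ler_pdivrMr //.
apply: (le_trans (ltW key)); rewrite invfM -mulrA mulrCA.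
apply: ler_peMr; first by rewrite invr_ge0 ltW.
by rewrite mulrC ler_pdivlMr // mul1r ler_nat.
Qed.

(* On a block of q terms the function y/(n+j) is within E of the linear function
   y/n - j p/q; as psi increases at most with slope 1, the error enters only
   through q E, whatever the number of jumps. *)
Lemma sum_psi_block (R : realType) (y : R) (n p q T : nat) :
  0 <= y -> (0 < n)%N -> (0 < q <= T)%N -> coprime p q ->
  `|y / n%:R ^+ 2 - p%:R / q%:R| <= (q%:R * T%:R)^-1 ->
  T%:R ^+ 3 * y <= n%:R ^+ 3 ->
  `|\sum_(0 <= j < q) psi (y / (n + j)%:R)| <= 9 / 2.
Proof.
move=> y0 n0 /andP[q0 qT] cpq happ hT.
have T0 : (0 < T)%N by apply: leq_trans qT.
have n0' : 0 < n%:R :> R by rewrite ltr0n.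
have q0' : 0 < q%:R :> R by rewrite ltr0n.
have T0' : 0 < T%:R :> R by rewrite ltr0n.
have qT' : q%:R <= T%:R :> R by rewrite ler_nat.
(* The first summand bounds [j] times the error in the slope, the second the remainder of order two
   of [y / (n + j)]. The bound on [T] makes each at most [1 / q]. *)
pose E : R := T%:R^-1 + q%:R ^+ 2 * y / n%:R ^+ 3.
have qE : q%:R * E <= 2.
  rewrite mulrDr; have -> : 2 = 1 + 1 :> R by ring.
  apply: lerD; first by rewrite ler_pdivrMr // mul1r.
  rewrite mulrA ler_pdivrMr ?exprn_gt0 // mul1r; apply: le_trans hT.
  rewrite mulrA -exprS ler_wpM2r // lerXn2r // nnegrE ltW //.
have E0 : 0 <= E.
  by apply: addr_ge0; rewrite ?invr_ge0 ?divr_ge0 ?mulr_ge0 ?exprn_ge0 // ltW.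
pose e (j : nat) : R := y / (n + j)%:R - (y / n%:R - j%:R * p%:R / q%:R).
have eE j : (j < q)%N -> `|e j| <= E.
  move=> jq; have jq' : j%:R <= q%:R :> R by rewrite ler_nat ltnW.
  have j0' : 0 <= j%:R :> R by rewrite ler0n.
  have nj0 : 0 < (n + j)%:R :> R by rewrite ltr0n addn_gt0 n0.
  (* Exact expansion: [y / (n + j) = y / n - j y / n^2 + j^2 y / (n^2 (n + j))]. *)
  have -> : e j = - j%:R * (y / n%:R ^+ 2 - p%:R / q%:R) +
                  j%:R ^+ 2 * y / (n%:R ^+ 2 * (n + j)%:R).
    rewrite /e natrD; field; rewrite -natrD !gt_eqF //.
  apply: (le_trans (ler_normD _ _)); apply: lerD.
    rewrite normrM normrN (ger0_norm j0').
    apply: (le_trans (ler_wpM2l j0' happ)).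
    rewrite invfM mulrA -[leRHS]mul1r ler_wpM2r ?invr_ge0 ?ltW //.
    by rewrite ltr_pdivrMr // mul1r ltr_nat.
  rewrite ger0_norm; last by rewrite divr_ge0 ?mulr_ge0 ?exprn_ge0 // ltW.
  apply: ler_pM.
  - by rewrite mulr_ge0 ?exprn_ge0.
  - by rewrite invr_ge0 mulr_ge0 ?exprn_ge0 // ltW.
  - by rewrite ler_wpM2r // lerXn2r // nnegrE ltW.
  rewrite lef_pV2 ?posrE ?mulr_gt0 ?exprn_gt0 // [leLHS]exprSr.
  by rewrite ler_wpM2l ?exprn_ge0 // ?ler_nat ?leq_addr // ltW.
have pw j : (0 <= j < q)%N ->
    psi ((y / n%:R + E) - j%:R * p%:R / q%:R) - 2 * E <= psi (y / (n + j)%:R) <=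
    psi ((y / n%:R - E) - j%:R * p%:R / q%:R) + 2 * E.
  move=> /eE /(psi_perturb _ (y / n%:R - j%:R * p%:R / q%:R)).
  rewrite (_ : _ + e j = y / (n + j)%:R); last by rewrite /e; ring.
  by rewrite (addrAC _ _ E) (addrAC _ _ (- E)).
(* Either side is bounded by [1/2 + 2 q E], and [q E <= 2] gives 9/2. *)
have h1 : \sum_(0 <= j < q) psi (y / (n + j)%:R) <= 2^-1 + 2 * (q%:R * E).
  apply: (@le_trans _ _ (\sum_(0 <= j < q) (psi ((y / n%:R - E) - j%:R * p%:R / q%:R) + 2 * E))).
    by apply: ler_sum_nat => j /pw /andP[].
  rewrite big_split /= sumr_const_nat subn0; apply: lerD; last by rewrite -[2 * E *+ q]mulr_natl mulrCA.
  exact: le_trans (ler_norm _) (sum_psi_rational _ _ _ _ q0 cpq).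
have h2 : - (2^-1 + 2 * (q%:R * E)) <= \sum_(0 <= j < q) psi (y / (n + j)%:R).
  apply: (@le_trans _ _ (\sum_(0 <= j < q) (psi ((y / n%:R + E) - j%:R * p%:R / q%:R) - 2 * E))); last first.
    by apply: ler_sum_nat => j /pw /andP[].
  rewrite sumrB /= sumr_const_nat subn0 opprD; apply: lerD; last by rewrite -[2 * E *+ q]mulr_natl mulrCA.
  rewrite lerNl; apply: le_trans (sum_psi_rational _ _ _ (y / n%:R + E) q0 cpq).
  by rewrite -[leRHS]normrN ler_norm.
rewrite ler_norml; apply/andP; split; lra.
Qed.

(** Write [i = n + j]: the constant weight [n] meets the cancellation [B], while the excess [j <= T]
    is estimated trivially over at most [T] terms. *)
Lemma weighted_sum_block (R : realType) (n q T : nat) (f : nat -> R) (B : R) :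
  (q <= T)%N -> (forall i, `|f i| <= 2^-1) ->
  `|\sum_(0 <= j < q) f (n + j)%N| <= B ->
  `|\sum_(n <= i < n + q) i%:R * f i| <= n%:R * B + T%:R ^+ 2 / 2.
Proof.
move=> qT f1 fB; rewrite -{1}[n]add0n big_addn addnC addnK.
under eq_bigr => j _ do rewrite natrD mulrDl addrC (addnC j).
rewrite big_split /= -mulr_sumr; apply: (le_trans (ler_normD _ _)); apply: lerD.
  by rewrite normrM normr_nat ler_wpM2l.
apply: (@le_trans _ _ (\sum_(0 <= j < q) T%:R / 2)); last first.
  rewrite sumr_const_nat subn0 -[_ / 2 *+ q]mulr_natl mulrA expr2 ler_wpM2r ?invr_ge0 //.
  by rewrite ler_wpM2r // ler_nat.
apply: (le_trans (ler_norm_sum _ _ _)); apply: ler_sum_nat => j /andP[_ jq].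
rewrite normrM normr_nat ler_pM // ler_nat; apply: leq_trans qT; exact: ltnW.
Qed.

(* The list s collects the starts of the blocks that fit below M; the last, incomplete
   block costs at most T B. *)
Lemma greedy_blocks (R : realType) (w : nat -> R) (Q : nat -> nat) (M T : nat) (W B : R) :
  0 <= W -> 0 <= B -> (forall i, (i < M)%N -> `|w i| <= B) ->
  forall a,
  (forall n, (a <= n < M)%N -> (0 < Q n <= T)%N /\ `|\sum_(n <= i < n + Q n) w i| <= W) ->
  exists s : seq nat, [/\ {in s, forall n, (a <= n < M)%N},
    pairwise (fun m n => (m + Q m <= n)%N) s &
    `|\sum_(a <= i < M) w i| <= W * (size s)%:R + T%:R * B].
Proof.
move=> W0 B0 wB a; move: {2}(M - a)%N (leqnn (M - a)) => k.
elim: k a => [|k IHk] a.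
  rewrite leqn0 subn_eq0 => Ma _; exists [::]; split => //.
  by rewrite big_geq // normr0 mulr0 add0r mulr_ge0.
move=> Mk hQ; case: (leqP M a) => [Ma|aM].
  by exists [::]; split => //; rewrite big_geq // normr0 mulr0 add0r mulr_ge0.
have [/andP[Q0 QT] hW] : (0 < Q a <= T)%N /\ `|\sum_(a <= i < a + Q a) w i| <= W.
  by apply: hQ; rewrite leqnn.
case: (leqP (a + Q a) M) => [le|gt]; last first.
  exists [::]; split => //; rewrite mulr0 add0r.
  apply: (@le_trans _ _ (\sum_(a <= i < M) B)).
    by apply: (le_trans (ler_norm_sum _ _ _)); apply: ler_sum_nat => j /andP[_ /wB].
  rewrite sumr_const_nat -[B *+ _]mulr_natl ler_wpM2r // ler_nat; lia.
have [||s [sI sP sB]] := IHk (a + Q a)%N; first by lia.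
  by move=> n /andP[n1 n2]; apply: hQ; rewrite n2 andbT; lia.
exists (a :: s); split.
- move=> n; rewrite inE => /orP[/eqP ->|/sI]; first by rewrite leqnn.
  by move=> /andP[h1 h2]; rewrite h2 andbT; lia.
- by rewrite /= sP andbT; apply/allP => n /sI /andP[].
rewrite (@big_cat_nat _ _ _ (a + Q a)) ?leq_addr //=.
apply: (le_trans (ler_normD _ _)).
rewrite -natr1; have := lerD hW sB; lra.
Qed.

(** Successive elements are at least [q] apart, so [size s - 1] gaps fit into [L]. Adding [q] on the
    right avoids the subtraction and covers the empty list. *)
Lemma size_gapped (s : seq nat) (Q : nat -> nat) (q L : nat) :
  {in s, forall n, Q n = q} -> pairwise (fun m n => (m + Q m <= n)%N) s ->
  {in s &, forall m n, (m < n)%N -> (n - m <= L)%N} -> (0 < q)%N ->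
  (size s * q <= L + q)%N.
Proof.
case: s => [|a s] //= hQ hp hL q0.
(* Here [s] is the tail, whose length is the number of gaps. *)
have {hp} : (a + size s * q <= last a s)%N.
  elim/last_ind: s hQ hp {hL} => [|s z IHs] hQ hp; first by rewrite /= mul0n addn0.
  rewrite last_rcons size_rcons mulSn.
  move: hp; rewrite -/(pairwise _ (a :: rcons s z)) -rcons_cons pairwise_rcons => /andP[hz hp].
  have /IHs/(_ hp) : {in a :: s, forall n, Q n = q}.
    by move=> n hn; apply: hQ; rewrite -rcons_cons mem_rcons inE hn orbT.
  have : (last a s + Q (last a s) <= z)%N by apply: (allP hz); rewrite mem_last.
  rewrite hQ; first by lia.
  by rewrite -rcons_cons mem_rcons inE mem_last orbT.
have := hL a (last a s); rewrite mem_head mem_last => /(_ isT isT).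
case: (ltnP a (last a s)) => [h1 /(_ isT) h2|h1 _] h3; rewrite mulSn; lia.
Qed.

(** Each element is counted once, at its own label [(Q n, P n)]. *)
Lemma size_labelled (s : seq nat) (Q P : nat -> nat) (T : nat) (N : nat -> nat) :
  {in s, forall n, (0 < Q n <= T)%N && (P n < N (Q n))%N} ->
  size s = (\sum_(1 <= q < T.+1) \sum_(0 <= p < N q)
             size [seq n <- s | (Q n == q) && (P n == p)])%N.
Proof.
elim: s => [|a s IHs] hs; first by rewrite big1 // => q _; rewrite big1.
have /andP[/andP[q0 qT] pN] := hs a (mem_head _ _).
rewrite /= IHs; last by move=> n hn; apply: hs; rewrite inE hn orbT.
have E1 : (\sum_(1 <= q < T.+1) \sum_(0 <= p < N q) ((Q a == q) && (P a == p)))%N = 1%N.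
  rewrite (bigD1_seq (Q a)) ?iota_uniq ?mem_index_iota ?q0 //=.
  rewrite (bigD1_seq (P a)) ?iota_uniq ?mem_index_iota ?pN //= !eqxx /=.
  rewrite !big1 // => [q|p] ne; last by rewrite eq_sym (negbTE ne).
  by rewrite big1 // => p _; rewrite eq_sym (negbTE ne).
rewrite -add1n -[X in (X + _)%N]E1.
rewrite -big_split; apply: eq_bigr => q _ /=; rewrite -big_split; apply: eq_bigr => p _ /=.
by case: ifP.
Qed.

(** * Counting the blocks *)

(** The induction step is [1 / (t + 1) <= ln ((t + 1) / t)], that is, [ln (1 + z) <= z] at
    [z = - 1 / (t + 1)]. *)
Lemma sum_inv_le (R : realType) (T : nat) : (0 < T)%N ->
  \sum_(1 <= q < T.+1) (q%:R^-1 : R) <= 1 + ln T%:R.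
Proof.
elim: T => [//|[|T] IHT _]; first by rewrite big_nat1 invr1 ln1 addr0.
rewrite big_nat_recr //=; have := IHT isT.
set t : R := T.+1%:R; have t0 : 0 < t by rewrite ltr0n.
have tE : T.+2%:R = t + 1 :> R by rewrite natr1.
rewrite tE => h.
have : ln (1 - (t + 1)^-1) <= - (t + 1)^-1.
  apply: le_ln1Dx; rewrite ltrN2 invf_lt1; lra.
have -> : 1 - (t + 1)^-1 = t / (t + 1) by field; lra.
rewrite ln_div ?posrE; lra.
Qed.

Lemma sum_inv_sqr_le (R : realType) (T : nat) :
  \sum_(1 <= q < T.+1) ((q%:R ^+ 2)^-1 : R) <= 2.
Proof.
(* Strengthened so that the induction telescopes, through [1 / (t + 1)^2 <= 1 / t - 1 / (t + 1)]. *)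
suff : \sum_(1 <= q < T.+2) ((q%:R ^+ 2)^-1 : R) <= 2 - T.+1%:R^-1.
  rewrite big_nat_recr //= => h.
  apply: (@le_trans _ _ (2 - T.+1%:R^-1)); last by rewrite gerBl invr_ge0.
  by apply: le_trans h; rewrite lerDl invr_ge0 exprn_ge0.
elim: T => [|T IHT]; first by rewrite big_nat1 expr1n invr1; lra.
rewrite big_nat_recr //=; apply: (le_trans (lerD IHT (lexx _))).
set t : R := T.+1%:R; have t0 : 0 < t by rewrite ltr0n.
have -> : T.+2%:R = t + 1 :> R by rewrite natr1.
have -> : t^-1 = (t + 1)^-1 + (t * (t + 1))^-1 by field; lra.
have : ((t + 1) ^+ 2)^-1 <= (t * (t + 1))^-1.
  by rewrite lef_pV2 ?posrE ?exprn_gt0 ?mulr_gt0 ?addr_gt0 // expr2 ler_wpM2r; lra.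
by move: ((t + 1) ^- 2) ((t * (t + 1))^-1) ((t + 1)^-1) => a b c; lra.
Qed.

(** The difference of slopes is [u^3 (b - a) (a + b) / (a^2 b^2)], and [a^2 b^2 <= 8 d^3 (a + b)];
    inserting [T >= d / (2 u)] yields 32. It serves for two points [a], [b] whose slopes are near
    the same fraction. *)
Lemma arc_length (R : realType) (u a b d q T : R) :
  0 < u -> 0 < a -> a <= b -> b <= 2 * d -> 0 < q -> 0 < T -> d <= 2 * u * T ->
  u ^+ 3 / a ^+ 2 - u ^+ 3 / b ^+ 2 <= 2 / (q * T) ->
  (b - a) * q <= 32 * d ^+ 2 / u ^+ 2.
Proof.
move=> u0 a0 ab bd q0 T0 dT h.
have b0 : 0 < b by lra.
have d0 : 0 < d by lra.
have h1 : u ^+ 3 * ((b - a) * q) * T * (a + b) <= 2 * (a ^+ 2 * b ^+ 2).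
  have -> : u ^+ 3 * ((b - a) * q) * T * (a + b) =
      (u ^+ 3 / a ^+ 2 - u ^+ 3 / b ^+ 2) * (q * T) * (a ^+ 2 * b ^+ 2).
    by field; rewrite !gt_eqF.
  rewrite ler_wpM2r ?mulr_ge0 ?exprn_ge0 ?(ltW a0) ?(ltW b0) //.
  by rewrite -ler_pdivlMr // mulr_gt0.
have h2 : a ^+ 2 * b ^+ 2 <= 8 * d ^+ 3 * (a + b).
  have a2 : a ^+ 2 <= (2 * d) ^+ 2 by rewrite lerXn2r ?nnegrE; lra.
  have b2 : b ^+ 2 <= 2 * d * (a + b) by rewrite expr2 ler_pM; lra.
  apply: le_trans (ler_pM _ _ a2 b2) _; rewrite ?exprn_ge0 ?(ltW a0) ?(ltW b0) //.
  by rewrite le_eqVlt; apply/orP; left; apply/eqP; ring.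
have h3 : u ^+ 3 * ((b - a) * q) * T <= 16 * d ^+ 3.
  have ab0 : 0 < a + b by lra.
  rewrite -(ler_pM2r ab0); apply: (le_trans h1); lra.
rewrite ler_pdivlMr ?exprn_gt0 //.
rewrite -(ler_pM2r d0); apply: (@le_trans _ _ ((b - a) * q * u ^+ 2 * (2 * u * T))).
  by rewrite ler_wpM2l // mulr_ge0 ?exprn_ge0 ?mulr_ge0 //; lra.
have -> : (b - a) * q * u ^+ 2 * (2 * u * T) = 2 * (u ^+ 3 * ((b - a) * q) * T) by ring.
have -> : 32 * d ^+ 2 * d = 2 * (16 * d ^+ 3) by ring.
by rewrite ler_wpM2l.
Qed.

(* Each q admits about q u^3/D^2 + 2 numerators p; the n whose slope is near p/q
   span at most 32 D^2/(u^2 q), and starts of blocks of length q are q apart. *)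
Lemma number_of_blocks (R : realType) (u : R) (D M T : nat) (s : seq nat) (Q P : nat -> nat) :
  1 <= u -> (0 < D)%N -> u <= D%:R -> (M <= 2 * D)%N -> (0 < T)%N ->
  T%:R <= D%:R / u -> D%:R <= 2 * u * T%:R ->
  {in s, forall n, [/\ (D <= n < M)%N, (0 < Q n <= T)%N &
     `|u ^+ 3 / n%:R ^+ 2 - (P n)%:R / (Q n)%:R| <= ((Q n)%:R * T%:R)^-1]} ->
  pairwise (fun m n => (m + Q m <= n)%N) s ->
  (size s)%:R <= 32 * u * (1 + ln T%:R) + u + 130 * D%:R ^+ 2 / u ^+ 2.
Proof.
move=> u1 D0 uD MD T0 Tu DT hs hp.
have u0 : 0 < u by lra.
set d : R := D%:R; have d0 : 0 < d by rewrite ltr0n.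
set t : R := T%:R; have t0 : 0 < t by rewrite ltr0n.
have y0 : 0 < u ^+ 3 by rewrite exprn_gt0.
(* Two units above the truncation: one for truncating, one for the approximation error
   [q / (q T) <= 1]. *)
pose Np (q : nat) := (Num.truncn (q%:R * u ^+ 3 / d ^+ 2)).+2.
pose La : R := 32 * d ^+ 2 / u ^+ 2.
have La0 : 0 <= La by rewrite divr_ge0 ?mulr_ge0 ?exprn_ge0 // ltW.
have hlab : {in s, forall n, (0 < Q n <= T)%N && (P n < Np (Q n))%N}.
  move=> n /hs [/andP[Dn nM] hQ happ]; rewrite hQ /=.
  case/andP: hQ => Q0 QT; rewrite /Np ltnS.
  case: (posnP (P n)) => [->//|P0]; rewrite -(prednK P0) ltnS.
  have q0 : 0 < (Q n)%:R :> R by rewrite ltr0n.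
  have h0 : 0 <= (Q n)%:R * u ^+ 3 / d ^+ 2 by rewrite divr_ge0 ?mulr_ge0 ?exprn_ge0 // ltW.
  rewrite -ltnS -(ltr_nat R).
  have /andP[_ h2] := truncn_itv h0.
  have : (P n)%:R / (Q n)%:R <= u ^+ 3 / n%:R ^+ 2 + ((Q n)%:R * t)^-1.
    by move: happ; rewrite ler_norml => /andP[]; rewrite -/t; lra.
  have : u ^+ 3 / n%:R ^+ 2 <= u ^+ 3 / d ^+ 2.
    rewrite ler_wpM2l ?(ltW y0) // lef_pV2 ?posrE ?exprn_gt0 // ?ltr0n ?(leq_trans D0) //.
    by rewrite lerXn2r ?nnegrE // ler_nat.
  have : (Q n)%:R * ((Q n)%:R * t)^-1 <= 1.
    rewrite invfM mulrA divff ?gt_eqF // mul1r invf_le1 // ler1n //.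
  move=> h3 h4 h5; have := le_trans h5 (lerD h4 (lexx _)).
  rewrite ler_pdivrMr // mulrDl => h6.
  have h7 : (P n)%:R < (Num.truncn ((Q n)%:R * u ^+ 3 / d ^+ 2)).+2%:R :> R.
    rewrite -natr1; have -> : (Q n)%:R * u ^+ 3 / d ^+ 2 = u ^+ 3 / d ^+ 2 * (Q n)%:R by ring.
    have := h2; have -> : (Q n)%:R * u ^+ 3 / d ^+ 2 = u ^+ 3 / d ^+ 2 * (Q n)%:R by ring.
    lra.
  by move: h7; rewrite !ltr_nat -{1}(prednK P0) ltnS.
(* Slopes within [1 / (q T)] of the same [p / q] differ by at most [2 / (q T)], so [arc_length]
   bounds the span by [La / q]. *)
have hcls (q p : nat) : (0 < q <= T)%N ->
    (size [seq n <- s | (Q n == q) && (P n == p)])%:R <= La / q%:R ^+ 2 + 1.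
  move=> /andP[q0 qT]; have q0' : 0 < q%:R :> R by rewrite ltr0n.
  set s' := [seq n <- s | _]; pose L := Num.truncn (La / q%:R).
  have hL0 : 0 <= La / q%:R by rewrite divr_ge0 // ltW.
  have sub n : n \in s' -> [/\ n \in s, Q n = q & P n = p].
    by rewrite mem_filter => /andP[/andP[/eqP ? /eqP ?] ?].
  have : (size s' * q <= L + q)%N.
    apply: (@size_gapped s' Q) => //.
    - by move=> n /sub[].
    - by apply: subseq_pairwise hp; apply: filter_subseq.
    move=> m n /sub[/hs [/andP[Dm _] _ hm] Qm Pm] /sub[/hs [/andP[_ nM] _ hn] Qn Pn] mn.
    rewrite /L truncn_ge_nat // natrB ?(ltnW mn) // ler_pdivlMr //.
    move: hm hn; rewrite Qm Pm Qn Pn => hm hn.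
    apply: (@arc_length R u m%:R n%:R d q%:R t) => //.
    - by rewrite ltr0n (leq_trans D0).
    - by rewrite ler_nat ltnW.
    - by rewrite /d -natrM ler_nat (leq_trans (ltnW nM)).
    move: hm hn; rewrite !ler_norml => /andP[_ hm] /andP[hn _]; rewrite -/t in hm hn; lra.
  rewrite -(ler_nat R) natrM natrD => h.
  have /andP[h1 _] := truncn_itv hL0.
  rewrite -(ler_pM2r q0'); apply: (le_trans h); rewrite mulrDl mul1r lerD2r.
  by apply: (le_trans h1); rewrite le_eqVlt; apply/orP; left; apply/eqP; field; rewrite gt_eqF.
rewrite (size_labelled _ _ _ _ _ hlab) natr_sum.
(* For each [q] this expands [(q u^3 / d^2 + 2) (La / q^2 + 1)], where [La u^3 / d^2 = 32 u]; in the
   term [q u^3 / d^2] the factor [q] is replaced by its bound [T]. *)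
apply: (@le_trans _ _ (\sum_(1 <= q < T.+1)
   (32 * u / q%:R + t * u ^+ 3 / d ^+ 2 + (2 * La) / q%:R ^+ 2 + 2))).
  apply: ler_sum_nat => q /andP[q0 qT]; have q0' : 0 < q%:R :> R by rewrite ltr0n.
  rewrite natr_sum.
  apply: (@le_trans _ _ (\sum_(0 <= p < Np q) (La / q%:R ^+ 2 + 1))).
    by apply: ler_sum_nat => p _; apply: hcls; rewrite q0.
  rewrite sumr_const_nat subn0 -[_ *+ Np q]mulr_natl.
  have h0 : 0 <= q%:R * u ^+ 3 / d ^+ 2 by rewrite divr_ge0 ?mulr_ge0 ?exprn_ge0 // ltW.
  have /andP[h1 _] := truncn_itv h0.
  have hN : (Np q)%:R <= q%:R * u ^+ 3 / d ^+ 2 + 2.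
    by rewrite /Np -natr1 -natr1; lra.
  apply: (@le_trans _ _ ((q%:R * u ^+ 3 / d ^+ 2 + 2) * (La / q%:R ^+ 2 + 1))).
    by apply: ler_wpM2r => //; rewrite addr_ge0 // divr_ge0 // exprn_ge0.
  have -> : (q%:R * u ^+ 3 / d ^+ 2 + 2) * (La / q%:R ^+ 2 + 1) =
     32 * u / q%:R + q%:R * u ^+ 3 / d ^+ 2 + 2 * La / q%:R ^+ 2 + 2.
    by rewrite /La; field; rewrite !gt_eqF.
  rewrite lerD2r lerD2r lerD2l ler_wpM2r ?invr_ge0 ?exprn_ge0 ?(ltW d0) //.
  by rewrite ler_wpM2r ?(ltW y0) // ler_nat.
(* The harmonic sum gives the logarithm, [T u <= d] bounds the second sum by [u], and 130 is 128
   from [4 La] plus 2 from [2 T <= 2 d^2 / u^2]. *)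
rewrite !big_split /= !sumr_const_nat -!mulr_sumr subn1 /=.
have hH := sum_inv_le R T T0; have hS := sum_inv_sqr_le R T.
have e1 : 32 * u * \sum_(1 <= i < T.+1) (i%:R^-1 : R) <= 32 * u * (1 + ln t).
  by rewrite ler_wpM2l // mulr_ge0 // ltW.
have e3 : 2 * La * \sum_(1 <= i < T.+1) ((i%:R ^+ 2)^-1 : R) <= 128 * d ^+ 2 / u ^+ 2.
  apply: (@le_trans _ _ (2 * La * 2)); first by rewrite ler_wpM2l // mulr_ge0.
  by rewrite le_eqVlt; apply/orP; left; apply/eqP; rewrite /La; field; rewrite gt_eqF.
have tu : t * u <= d by rewrite -ler_pdivlMr.
have e2 : (t * u ^+ 3 / d ^+ 2) *+ T <= u.
  rewrite -[_ *+ T]mulr_natl -/t mulrA ler_pdivrMr ?exprn_gt0 //.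
  have -> : t * (t * u ^+ 3) = u * (t * u) ^+ 2 by ring.
  by rewrite ler_wpM2l ?(ltW u0) // lerXn2r ?nnegrE ?mulr_ge0 // ltW.
have e4 : 2 *+ T <= 2 * d ^+ 2 / u ^+ 2.
  rewrite -[_ *+ T]mulr_natl -/t mulrC -mulrA ler_wpM2l //.
  apply: (@le_trans _ _ (d / u)); first by rewrite ler_pdivlMr.
  rewrite -expr_div_n; apply: ler_eXnr => //; by rewrite ler_pdivlMr // mul1r.
have -> : 130 * d ^+ 2 / u ^+ 2 = 128 * d ^+ 2 / u ^+ 2 + 2 * d ^+ 2 / u ^+ 2 by ring.
lra.
Qed.

(** On a dyadic piece every block of the greedy decomposition costs at most [10 D], and
    [number_of_blocks] counts them. *)
Lemma short_sum_psi (R : realType) (u : R) (D M : nat) :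
  1 <= u -> u <= D%:R -> D%:R <= u ^+ 2 -> (M <= 2 * D)%N ->
  `|\sum_(D <= n < M) n%:R * psi (u ^+ 3 / n%:R)| <=
  331 * (D%:R * u * (1 + ln u)) + 1300 * (D%:R ^+ 3 / u ^+ 2).
Proof.
move=> u1 uD Du MD; have u0 : 0 < u by lra.
have D0 : (0 < D)%N by rewrite -(ltr_nat R); lra.
set d : R := D%:R in uD Du *; have d0 : 0 < d by lra.
have y0 : 0 < u ^+ 3 by rewrite exprn_gt0.
(* The largest order for which [T^3 u^3 <= n^3] holds for all [n >= D], as [sum_psi_block]
   requires. *)
pose T := Num.truncn (d / u).
have du0 : 0 <= d / u by rewrite divr_ge0 // ltW.
have /andP[Tdu duT] := truncn_itv du0; rewrite -/T in Tdu duT.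
have T0 : (0 < T)%N by rewrite /T truncn_ge_nat // ler_pdivlMr // mul1r.
have T1 : 1 <= T%:R :> R by rewrite ler1n.
have DT : d <= 2 * u * T%:R.
  move: duT; rewrite ltr_pdivrMr // -natr1 => /ltW h; apply: (le_trans h); nra.
have tu : T%:R * u <= d by rewrite -ler_pdivlMr.
have Tu : T%:R <= u.
  by apply: (le_trans Tdu); rewrite ler_pdivrMr // -expr2.
have /choice[PQ hPQ] : forall n : nat, exists pq : nat * nat,
    [/\ (0 < pq.2 <= T)%N, coprime pq.1 pq.2 &
    `|u ^+ 3 / n%:R ^+ 2 - pq.1%:R / pq.2%:R| <= (pq.2%:R * T%:R)^-1].
  move=> n; have [||p [q h]] := @dirichlet_approximation R (u ^+ 3 / n%:R ^+ 2) T.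
  - by rewrite divr_ge0 ?exprn_ge0 // ltW.
  - exact: T0.
  by exists (p, q).
have T2 : T%:R ^+ 2 <= d.
  rewrite -(ler_pM2r (exprn_gt0 2 u0)) -exprMn.
  apply: (@le_trans _ _ (d ^+ 2)); first by rewrite lerXn2r ?nnegrE ?mulr_ge0 // ltW.
  by rewrite expr2 ler_wpM2l // ltW.
have T3 : T%:R ^+ 3 * u ^+ 3 <= d ^+ 3.
  by rewrite -exprMn lerXn2r ?nnegrE ?mulr_ge0 // ltW.
have Md : M%:R <= 2 * d by rewrite /d -natrM ler_nat.
have nd n : (n < M)%N -> n%:R <= 2 * d.
  by move=> nM; apply: le_trans Md; rewrite ler_nat ltnW.
(* A block costs at most [2 d * 9/2 + T^2 / 2 <= 10 d], by [T^2 <= d]; a single term costs at most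
   [2 d / 2 = d]. *)
have [||||s [sI sP sB]] := @greedy_blocks R (fun n => n%:R * psi (u ^+ 3 / n%:R))
    (fun n => (PQ n).2) M T (10 * d) d _ _ _ D.
- by lra.
- by lra.
- move=> i /nd iM; rewrite normrM normr_nat.
  by have := ler_wpM2l (ler0n R i) (psi_bound R (u ^+ 3 / i%:R)); lra.
- move=> n /andP[Dn nM]; have [hq hc ha] := hPQ n; split=> //.
  apply: le_trans (weighted_sum_block _ n (PQ n).2 T (fun i => psi (u ^+ 3 / i%:R)) (9 / 2) _ _ _) _.
  + by case/andP: hq.
  + by move=> i; apply: psi_bound.
  + apply: (sum_psi_block _ _ _ (PQ n).1 _ T) => //; first exact: ltW.
      exact: leq_trans Dn.
    by apply: (le_trans T3); rewrite lerXn2r ?nnegrE ?(ltW d0) // ler_nat.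
  have := nd n nM; lra.
apply: (le_trans sB).
have hsz : (size s)%:R <= 32 * u * (1 + ln T%:R) + u + 130 * d ^+ 2 / u ^+ 2.
  apply: (@number_of_blocks R u D M T s (fun n => (PQ n).2) (fun n => (PQ n).1)) => //.
  by move=> n /sI hn; have [hq hc ha] := hPQ n.
have lT : ln T%:R <= ln u by rewrite ler_ln ?posrE // ltr0n.
have lu0 : 0 <= ln u by apply: ln_ge0.
have Tdd : T%:R * d <= u * d by rewrite ler_wpM2r // ltW.
have e1 : u * (1 + ln T%:R) <= u * (1 + ln u) by rewrite ler_wpM2l ?(ltW u0) // lerD2l.
have e2 : u <= u * (1 + ln u) by rewrite ler_peMr ?(ltW u0) // lerDl.
have hsz' : (size s)%:R <= 33 * (u * (1 + ln u)) + 130 * (d ^+ 2 / u ^+ 2).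
  by move: hsz; rewrite -!mulrA; lra.
have hd : d * (size s)%:R <= d * (33 * (u * (1 + ln u)) + 130 * (d ^+ 2 / u ^+ 2)).
  by rewrite ler_wpM2l // ltW.
have e3 : d * u <= d * u * (1 + ln u).
  by rewrite ler_peMr ?lerDl // mulr_ge0 // ltW.
(* 331 is [10 * 33], plus 1 for the incomplete block of cost [T d <= u d]. *)
have -> : 331 * (d * u * (1 + ln u)) + 1300 * (d ^+ 3 / u ^+ 2) =
  10 * (d * (33 * (u * (1 + ln u)) + 130 * (d ^+ 2 / u ^+ 2))) + d * u * (1 + ln u).
  by rewrite exprS; ring.
have -> : 10 * d * (size s)%:R = 10 * (d * (size s)%:R) by ring.
apply: lerD; first by rewrite ler_wpM2l.
by apply: (le_trans Tdd); rewrite mulrC.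
Qed.

(* The parameter u is y^(1/3); halving m makes the dyadic pieces sum up without an
   additional logarithm. *)
Lemma sum_psi_le (R : realType) (u : R) (m : nat) : 1 <= u -> m%:R <= u ^+ 2 ->
  `|\sum_(1 <= n < m.+1) n%:R * psi (u ^+ 3 / n%:R)| <=
  700 * (m%:R * u * (1 + ln u)) + 1500 * (m%:R ^+ 3 / u ^+ 2).
Proof.
move=> u1; have u0 : 0 < u by lra.
have lu0 : 0 <= ln u by apply: ln_ge0.
elim/ltn_ind: m => m IHm mu2.
have m0 : 0 <= m%:R :> R by [].
have A0 : 0 <= m%:R * u * (1 + ln u) by rewrite !mulr_ge0 ?addr_ge0 // ltW.
have B0 : 0 <= m%:R ^+ 3 / u ^+ 2 by rewrite divr_ge0 ?exprn_ge0 // ltW.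
(* For [m <= 2 u] the trivial bound [m / 2 <= u] per term is enough; beyond, the upper half starts
   at some [D >= u]. *)
case: (lerP m%:R (2 * u)) => hm.
  apply: (@le_trans _ _ (m%:R * u * (1 + ln u))); last by lra.
  apply: (@le_trans _ _ (\sum_(1 <= n < m.+1) u)).
    apply: (le_trans (ler_norm_sum _ _ _)); apply: ler_sum_nat => n /andP[_ nm].
    have nm' : n%:R <= m%:R :> R by rewrite ler_nat -ltnS.
    by rewrite normrM normr_nat; have := ler_wpM2l (ler0n R n) (psi_bound R (u ^+ 3 / n%:R)); lra.
  rewrite sumr_const_nat subn1 /= -[_ *+ m]mulr_natl ler_peMr ?lerDl //.
  by rewrite mulr_ge0 // ltW.
have m1 : (1 < m)%N by rewrite -(ltr_nat R); lra.
set h := m./2; set D := h.+1.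
have [Dm MD] : (D <= m)%N /\ (m.+1 <= 2 * D)%N.
  by rewrite /D /h; move: m1; clear; lia.
have hm2 : h%:R <= m%:R / 2 :> R.
  by rewrite ler_pdivlMr // -natrM ler_nat muln2 -[leqRHS](odd_double_half m) leq_addl.
have Dm' : D%:R <= m%:R :> R by rewrite ler_nat.
have uD : u <= D%:R.
  have : m.+1%:R <= (2 * D)%:R :> R by rewrite ler_nat.
  by rewrite natrM -natr1; lra.
have h_lt : (h < m)%N by [].
have /IHm := h_lt; have -> : h%:R <= u ^+ 2 by lra.
move=> /(_ isT) Sh.
have Du : D%:R <= u ^+ 2 by lra.
have Sd := short_sum_psi R u D m.+1 u1 uD Du MD.
rewrite (@big_cat_nat _ _ _ D) //=; last by rewrite ltnW.
apply: (le_trans (ler_normD _ _)); apply: (le_trans (lerD Sh Sd)).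
have a1 : h%:R * u * (1 + ln u) <= m%:R * u * (1 + ln u) / 2.
  have -> : m%:R * u * (1 + ln u) / 2 = m%:R / 2 * (u * (1 + ln u)) by ring.
  by rewrite -mulrA ler_wpM2r // mulr_ge0 ?addr_ge0 // ltW.
have a2 : D%:R * u * (1 + ln u) <= m%:R * u * (1 + ln u).
  by rewrite -!mulrA ler_wpM2r // mulr_ge0 ?addr_ge0 // ltW.
have a3 : h%:R ^+ 3 / u ^+ 2 <= m%:R ^+ 3 / u ^+ 2 / 8.
  have -> : m%:R ^+ 3 / u ^+ 2 / 8 = (m%:R / 2) ^+ 3 / u ^+ 2 by rewrite expr_div_n; field; lra.
  by rewrite ler_wpM2r ?invr_ge0 ?exprn_ge0 ?(ltW u0) // lerXn2r ?nnegrE ?divr_ge0.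
have a4 : D%:R ^+ 3 / u ^+ 2 <= m%:R ^+ 3 / u ^+ 2.
  by rewrite ler_wpM2r ?invr_ge0 ?exprn_ge0 ?(ltW u0) // lerXn2r ?nnegrE.
(* The induction closes because [700 / 2 + 331 <= 700] and [1500 / 8 + 1300 <= 1500]. *)
have key (a b c d A B : R) : a <= A / 2 -> c <= A -> b <= B / 8 -> d <= B -> 0 <= A -> 0 <= B ->
    700 * a + 1500 * b + (331 * c + 1300 * d) <= 700 * A + 1500 * B.
  by clear; lra.
exact: key.
Qed.

(** * Assembling the error terms *)

(** Truncating [y] before dividing by an integer does not change the integer part of the
    quotient. *)
Lemma psi_divn (R : realType) (y : R) (d : nat) : 0 <= y -> (0 < d)%N ->
  (Num.truncn y %/ d)%:R = y / d%:R - psi (y / d%:R) - 2^-1 :> R.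
Proof.
move=> y0 d0; set Y := Num.truncn y; have d0' : 0 < d%:R :> R by rewrite ltr0n.
have /andP[Yy yY] := truncn_itv y0; rewrite -/Y in Yy yY.
rewrite (psi_unique _ _ (y / d%:R - (Y %/ d)%:R) (Y %/ d)%N).
- ring.
- apply/andP; split.
    rewrite subr_ge0 ler_pdivlMr // -natrM; apply: le_trans Yy.
    by rewrite ler_nat leq_trunc_div.
  rewrite ltrBlDl natr1 ltr_pdivrMr // -natrM; apply: (lt_le_trans yY).
  by rewrite ler_nat mulnC mulnS; have := divn_eq Y d; have := ltn_pmod Y d0; lia.
- by rewrite -pmulrn; ring.
Qed.

Lemma divn_le (R : realType) (x : R) (k : nat) : 0 <= x -> (0 < k)%N ->
  (Num.truncn x %/ k)%:R <= x / k%:R.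
Proof.
move=> x0 k0; rewrite ler_pdivlMr ?ltr0n // -natrM.
have /andP[h _] := truncn_itv x0; apply: le_trans h.
by rewrite ler_nat leq_trunc_div.
Qed.

Lemma norm_sum_mobius_le (R : realType) (X : nat) (f g : nat -> R) :
  (forall k, (0 < k <= X)%N -> `|f k| <= g k) ->
  `|\sum_(1 <= k < X.+1) (mobius k)%:~R * f k| <= \sum_(1 <= k < X.+1) g k.
Proof.
move=> fg; apply: (le_trans (ler_norm_sum _ _ _)); apply: ler_sum_nat => k hk.
rewrite normrM -intr_norm -[g k]mul1r ler_pM ?fg ?ler0z ?normr_ge0 //.
by rewrite -[leRHS]/(1%:~R) ler_int norm_mobius.
Qed.

(** Each [d ^ b] times the integer part of [y / d ^ b] is [y] minus [d ^ b] times a fractional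
    part. *)
Lemma C1sum_fractional (R : realType) (b : nat) (x y : R) :
  (0 < b)%N -> 1 <= x -> 0 <= y ->
  C1sum b x y = (y - \sum_(1 <= k < (Num.truncn x).+1) (mobius k)%:~R *
    \sum_(1 <= d < (Num.truncn x %/ k).+1)
      (d ^ b)%:R * (psi (y / (d ^ b)%:R) + 2^-1))%:C.
Proof.
move=> b0 x1 y0; rewrite C1sum_mobius //; congr (_%:C).
set X := Num.truncn x.
have X0 : (0 < X)%N by rewrite /X truncn_ge_nat //; lra.
(* Regrouped by [q = k d], the coefficient of [y] is a sum of [mobius] over divisors, nonzero only
   at [q = 1]. *)
have Ey : \sum_(1 <= k < X.+1) \sum_(1 <= d < (X %/ k).+1) ((mobius k)%:~R * y) = y.
  rewrite -(@sum_hyperbola _ X (fun k _ => (mobius k)%:~R * y)).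
  under eq_big_nat => q /andP[q0 _].
    by rewrite -mulr_suml -rmorph_sum sum_mobius //; over.
  rewrite big_ltn // mul1r big_nat_cond big1 ?addr0 // => q /andP[/andP[q1 _] _].
  by rewrite (gtn_eqF q1) mul0r.
rewrite -[A in _ = A - _]Ey -sumrB; apply: eq_bigr => k _; rewrite -mulr_sumr -mulrBr; congr (_ * _).
rewrite -sumrB; apply: eq_big_nat => d /andP[d0 _].
have db0 : (0 < d ^ b)%N by rewrite expn_gt0 d0.
by rewrite psi_divn //; field; rewrite pnatr_eq0 -lt0n.
Qed.

(** Fractional parts are at most 1, so the inner sum is at most
    [(x / k)^(b + 1) <= x^(b + 1) / k^2]; the inverse squares sum to at most 2. *)
Lemma C1sum_trivial (R : realType) (b : nat) (x y : R) :
  (0 < b)%N -> 1 <= x -> 0 <= y ->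
  `|C1sum b x y - y%:C| <= (2 * x ^+ b.+1)%:C.
Proof.
move=> b0 x1 y0; rewrite C1sum_fractional // -rmorphB /= normc_def /= expr0n addr0 sqrtr_sqr lecR.
rewrite addrAC subrr add0r normrN; set X := Num.truncn x.
apply: (@le_trans _ _ (\sum_(1 <= k < X.+1) (x ^+ b.+1 * (k%:R ^+ 2)^-1))); last first.
  rewrite -mulr_sumr mulrC ler_wpM2r ?exprn_ge0 //; last by rewrite sum_inv_sqr_le.
  lra.
apply: norm_sum_mobius_le => k /andP[k0 kX].
have k0' : 0 < k%:R :> R by rewrite ltr0n.
have k1 : 1 <= k%:R :> R by rewrite ler1n.
have x0 : 0 <= x by lra.
have hN := divn_le R x k x0 k0; rewrite -/X in hN.
apply: (@le_trans _ _ (\sum_(1 <= d < (X %/ k).+1) (x / k%:R) ^+ b)).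
  apply: (le_trans (ler_norm_sum _ _ _)); apply: ler_sum_nat => d /andP[d0 dX].
  have hp : `|psi (y / (d ^ b)%:R) + 2^-1| <= 1.
    by have := psi_bound R (y / (d ^ b)%:R); rewrite !ler_norml; lra.
  rewrite normrM normr_nat -[leRHS]mulr1 ler_pM //.
  rewrite natrX lerXn2r ?nnegrE ?divr_ge0 //; apply: le_trans hN.
  by rewrite ler_nat -ltnS.
rewrite sumr_const_nat subn1 /= -[_ *+ (X %/ k)]mulr_natl.
apply: (@le_trans _ _ ((x / k%:R) ^+ b.+1)).
  by rewrite exprS ler_wpM2r // exprn_ge0 // divr_ge0.
rewrite expr_div_n ler_wpM2l ?exprn_ge0 // lef_pV2 ?posrE ?exprn_gt0 //.
by rewrite ler_weXn2l.
Qed.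

(** * Moebius sums and the secondary main term *)

(** Comparison with a telescoping sum; the same bound provides the convergence that gives [limn] its
    meaning. *)
Lemma zeta2_tail (R : realType) (N : nat) : (0 < N)%N ->
  0 <= zeta (2 : R) - \sum_(1 <= d < N.+1) (d%:R ^+ 2)^-1 <= N%:R^-1.
Proof.
move=> N0; set f : nat -> R := fun k => k.+1%:R `^ (- 2).
have serE n : series f n = \sum_(1 <= d < n.+1) (d%:R ^+ 2)^-1.
  rewrite /series /= big_add1; apply: eq_bigr => k _.
  by rewrite /f powRN powR_mulrn.
have nd : nondecreasing_seq (series f).
  by apply: nondecreasing_series => n _ _; rewrite /f powR_ge0.
have tail n : series f (N + n)%N <= series f N + N%:R^-1 - (N + n)%:R^-1.
  elim: n => [|n IHn]; first by rewrite addn0; lra.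
  rewrite addnS seriesS -addnS; apply: (le_trans (lerD (lexx _) IHn)).
  have t0 : 0 < (N + n)%:R :> R by rewrite ltr0n addn_gt0 N0.
  have -> : f (N + n)%N = (((N + n)%:R + 1) ^+ 2)^-1 :> R.
    by rewrite /f powRN powR_mulrn // -natr1.
  rewrite addnS -natr1; move: (series f N) (N%:R^-1) t0; move: (N + n)%:R => t s i t0.
  have e1 : t^-1 = (t + 1)^-1 + (t * (t + 1))^-1 by field; lra.
  have : ((t + 1) ^+ 2)^-1 <= (t * (t + 1))^-1.
    by rewrite lef_pV2 ?posrE ?exprn_gt0 ?mulr_gt0 ?addr_gt0 // expr2 ler_wpM2r; lra.
  by rewrite e1; move: ((t + 1) ^- 2) ((t * (t + 1))^-1) ((t + 1)^-1) => a b c; lra.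
have ub n : series f n <= series f N + N%:R^-1.
  case: (leqP N n) => [/subnKC <-|/ltnW nN].
    by apply: (le_trans (tail _)); rewrite gerBl invr_ge0.
  by apply: (le_trans (nd _ _ nN)); rewrite lerDl invr_ge0.
have cv : cvgn (series f).
  apply: nondecreasing_is_cvgn => //.
  by exists (series f N + N%:R^-1) => _ [n _ <-].
rewrite -serE /zeta -/f; apply/andP; split.
  by rewrite subr_ge0; apply: nondecreasing_cvgn_le.
by rewrite lerBlDl; apply: limr_le => //; near=> n; exact: ub.
Unshelve. all: by end_near.
Qed.

(** With partial sums [Zp (X %/ k)] in place of [zeta 2] there is an exact identity [e1]. Replacing
    each by [zeta 2] costs a tail of size [2 k / x], and division by [zeta 2 >= 1] concludes. *)
Lemma sum_mobius_sqr (R : realType) (x : R) : 1 <= x ->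
  `|\sum_(1 <= k < (Num.truncn x).+1) (mobius k)%:~R * (k%:R ^+ 2)^-1 - (zeta (2 : R))^-1|
  <= 2 * (1 + ln x) / x.
Proof.
move=> x1; set X := Num.truncn x; set S := \sum_(_ <= _ < _) _.
have x0 : 0 <= x by lra.
have x0' : 0 < x by lra.
have X0 : (0 < X)%N by rewrite /X truncn_ge_nat.
have z1 : 1 <= zeta (2 : R).
  by have := zeta2_tail R 1 isT; rewrite big_nat1 expr1n invr1; lra.
pose Zp (N : nat) : R := \sum_(1 <= d < N.+1) (d%:R ^+ 2)^-1.
have e1 : \sum_(1 <= k < X.+1) (mobius k)%:~R * ((k%:R ^+ 2)^-1 * Zp (X %/ k)%N) = 1 :> R.
  under eq_bigr do rewrite /Zp mulrA mulr_sumr.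
  rewrite -(@sum_hyperbola _ X (fun k d => (mobius k)%:~R * (k%:R ^+ 2)^-1 * (d%:R ^+ 2)^-1)).
  transitivity (\sum_(1 <= q < X.+1) (q == 1%N)%:R * (q%:R ^+ 2)^-1 : R).
    apply: eq_big_nat => q /andP[q0 _].
    rewrite -[X in _ = X%:R * _]/(nat_of_bool _) -(rmorph_nat (intmul (1 : R))) -sum_mobius //.
    rewrite rmorph_sum mulr_suml big_seq [RHS]big_seq; apply: eq_bigr => e.
    rewrite -dvdn_divisors // => eq_; rewrite -mulrA -invfM -exprMn -natrM.
    by rewrite mulnC divnK.
  rewrite big_ltn // expr1n invr1 mulr1 big_nat_cond big1 ?addr0 //.
  by move=> q /andP[/andP[q1 _] _]; rewrite (gtn_eqF q1) mul0r.
have e2 : S * zeta (2 : R) - 1 = \sum_(1 <= k < X.+1)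
    (mobius k)%:~R * ((k%:R ^+ 2)^-1 * (zeta (2 : R) - Zp (X %/ k)%N)).
  rewrite -[A in _ - A]e1 /S mulr_suml -sumrB; apply: eq_bigr => k _; ring.
have e3 : `|S * zeta (2 : R) - 1| <= \sum_(1 <= k < X.+1) (2 / x) * (k%:R^-1 : R).
  rewrite e2; apply: norm_sum_mobius_le => k /andP[k0 kX].
  have k0' : 0 < k%:R :> R by rewrite ltr0n.
  have N0 : (0 < X %/ k)%N by rewrite divn_gt0.
  have N0' : 0 < (X %/ k)%:R :> R by rewrite ltr0n.
  have /andP[t0 t1] := zeta2_tail R (X %/ k) N0.
  rewrite ger0_norm; last by rewrite mulr_ge0 // invr_ge0 exprn_ge0.
  (* [x < X + 1 <= 2 k (X %/ k)], as the quotient is at least 1. *)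
  have t2 : (X %/ k)%:R^-1 <= 2 * k%:R / x.
    rewrite -[X in X <= _]mul1r ler_pdivrMr // mulrAC ler_pdivlMr // mul1r.
    have /andP[_ /ltW h] := truncn_itv x0; apply: (le_trans h).
    rewrite -!natrM ler_nat -/X; have := divn_eq X k; have := ltn_pmod X k0.
    by move: N0; move: (X %/ k)%N (X %% k)%N; clear; move=> n r; nia.
  apply: (@le_trans _ _ ((k%:R ^+ 2)^-1 * (2 * k%:R / x))).
    by rewrite ler_wpM2l ?invr_ge0 ?exprn_ge0 //; apply: le_trans t2.
  by rewrite le_eqVlt; apply/orP; left; apply/eqP; field; rewrite !gt_eqF.
have e4 : `|S * zeta (2 : R) - 1| <= 2 * (1 + ln x) / x.
  apply: (le_trans e3); rewrite -mulr_sumr mulrAC ler_wpM2r ?invr_ge0 // ler_wpM2l //.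
  apply: (le_trans (sum_inv_le R X X0)); rewrite lerD2l ler_ln ?posrE ?ltr0n //.
  by have /andP[] := truncn_itv x0.
have -> : S - (zeta (2 : R))^-1 = (S * zeta (2 : R) - 1) / zeta (2 : R).
  by field; rewrite gt_eqF //; lra.
rewrite normrM normfV (@ger0_norm _ (zeta (2 : R))); last by lra.
rewrite ler_pdivrMr; last by lra.
apply: (le_trans e4); rewrite ler_peMr // divr_ge0 ?mulr_ge0 ?addr_ge0 // ln_ge0 //.
Qed.

(** The inner sum is a triangular number within [x / (2 k)] of [(x / k)^2 / 2]; what is left is
    [sum_mobius_sqr] scaled by [x^2 / 2]. *)
Lemma sum_mobius_triangle (R : realType) (x : R) : 1 <= x ->
  `|\sum_(1 <= k < (Num.truncn x).+1) (mobius k)%:~R *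
      \sum_(1 <= d < (Num.truncn x %/ k).+1) d%:R - x ^+ 2 / (2 * zeta (2 : R))|
  <= 2 * x * (1 + ln x).
Proof.
move=> x1; set X := Num.truncn x.
have x0 : 0 <= x by lra.
have x0' : 0 < x by lra.
have X0 : (0 < X)%N by rewrite /X truncn_ge_nat.
set S := \sum_(1 <= k < _) _.
pose T : R := \sum_(1 <= k < X.+1) (mobius k)%:~R * (k%:R ^+ 2)^-1.
have e1 : `|S - x ^+ 2 / 2 * T| <= \sum_(1 <= k < X.+1) (x / 2) * (k%:R^-1 : R).
  rewrite /S /T mulr_sumr -sumrB.
  under eq_bigr => k _ do rewrite mulrCA -mulrBr.
  apply: norm_sum_mobius_le => k /andP[k0 kX].
  have k0' : 0 < k%:R :> R by rewrite ltr0n.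
  have -> : \sum_(1 <= d < (X %/ k).+1) d%:R = (X %/ k)%:R * ((X %/ k)%:R + 1) / 2 :> R.
    elim: (X %/ k)%N => [|n IHn]; first by rewrite big_geq // mul0r mul0r.
    by rewrite big_nat_recr //= IHn -natr1; field.
  have hN : 1 <= (X %/ k)%:R :> R by rewrite ler1n divn_gt0.
  have h1 := divn_le R x k x0 k0; rewrite -/X in h1.
  have h2 : x / k%:R <= (X %/ k)%:R + 1.
    rewrite ler_pdivrMr // natr1 -natrM.
    have /andP[_ /ltW h] := truncn_itv x0; apply: (le_trans h).
    rewrite ler_nat -/X; have := divn_eq X k; have := ltn_pmod X k0.
    by move: (X %/ k)%N (X %% k)%N; clear; move=> n r; nia.
  have -> : x ^+ 2 / 2 * (k%:R ^+ 2)^-1 = (x / k%:R) ^+ 2 / 2 by field; rewrite gt_eqF.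
  have -> : x / 2 * k%:R^-1 = x / k%:R / 2 by ring.
  (* With [n <= t <= n + 1], both [n^2 + n - t^2] and its negative are at most [t]. *)
  move: hN h1 h2; move: (X %/ k)%:R (x / k%:R); clear=> n t h0 h1 h2.
  by rewrite ler_norml; apply/andP; split; nra.
have e2 : `|S - x ^+ 2 / 2 * T| <= x / 2 * (1 + ln x).
  apply: (le_trans e1); rewrite -mulr_sumr ler_wpM2l ?divr_ge0 //.
  apply: (le_trans (sum_inv_le R X X0)); rewrite lerD2l ler_ln ?posrE ?ltr0n //.
  by have /andP[] := truncn_itv x0.
have e3 := sum_mobius_sqr R x x1; rewrite -/X -/T in e3.
have e4 : `|x ^+ 2 / 2 * T - x ^+ 2 / (2 * zeta (2 : R))| <= x * (1 + ln x).
  rewrite invfM mulrA -mulrBr normrM ger0_norm ?divr_ge0 ?exprn_ge0 //.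
  have -> : x * (1 + ln x) = x ^+ 2 / 2 * (2 * (1 + ln x) / x) by field; rewrite gt_eqF.
  by rewrite ler_wpM2l // divr_ge0 // exprn_ge0.
have l0 : 0 <= x * (1 + ln x) by rewrite mulr_ge0 // addr_ge0 // ln_ge0.
apply: (le_trans (ler_distD (x ^+ 2 / 2 * T) _ _)); lra.
Qed.

Lemma sum_mobius_psi (R : realType) (x u : R) : 1 <= x -> 1 <= u -> x <= u ^+ 2 ->
  `|\sum_(1 <= k < (Num.truncn x).+1) (mobius k)%:~R *
      \sum_(1 <= d < (Num.truncn x %/ k).+1) d%:R * psi (u ^+ 3 / d%:R)|
  <= 700 * (x * u * (1 + ln u) * (1 + ln x)) + 3000 * (x ^+ 3 / u ^+ 2).
Proof.
move=> x1 u1 xu; set X := Num.truncn x.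
have x0 : 0 <= x by lra.
have u0 : 0 < u by lra.
have X0 : (0 < X)%N by rewrite /X truncn_ge_nat.
have lu0 : 0 <= ln u by apply: ln_ge0.
pose A : R := x * u * (1 + ln u); pose B : R := x ^+ 3 / u ^+ 2.
have A0 : 0 <= A by rewrite !mulr_ge0 ?addr_ge0 // ltW.
have B0 : 0 <= B by rewrite divr_ge0 ?exprn_ge0 // ltW.
apply: (@le_trans _ _ (\sum_(1 <= k < X.+1)
    ((700 * A) * k%:R^-1 + (1500 * B) * (k%:R ^+ 2)^-1))).
  apply: norm_sum_mobius_le => k /andP[k0 kX].
  have k0' : 0 < k%:R :> R by rewrite ltr0n.
  have k1 : 1 <= k%:R :> R by rewrite ler1n.
  have h1 := divn_le R x k x0 k0; rewrite -/X in h1.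
  have xk : x / k%:R <= x by rewrite ler_pdivrMr // ler_peMr.
  have xk0 : 0 <= x / k%:R by rewrite divr_ge0.
  apply: (le_trans (sum_psi_le R u (X %/ k) u1 (le_trans h1 (le_trans xk xu)))).
  have hA : (X %/ k)%:R * u * (1 + ln u) <= A * k%:R^-1.
    have -> : A * k%:R^-1 = x / k%:R * (u * (1 + ln u)) by rewrite /A; ring.
    by rewrite -mulrA ler_wpM2r // mulr_ge0 ?addr_ge0 // ltW.
  have hB : (X %/ k)%:R ^+ 3 / u ^+ 2 <= B * (k%:R ^+ 2)^-1.
    (* One factor [x / k] is bounded by [x], which leaves inverse squares of sum at most 2; hence
       3000 from 1500. *)
    have -> : B * (k%:R ^+ 2)^-1 = (x / k%:R) ^+ 2 * x / u ^+ 2.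
      by rewrite /B; field; rewrite !gt_eqF.
    rewrite ler_wpM2r ?invr_ge0 ?exprn_ge0 ?(ltW u0) // exprSr ler_pM ?exprn_ge0 //.
      by rewrite lerXn2r ?nnegrE.
    exact: le_trans xk.
  move: hA hB; move: (_ * _ * _) (_ / u ^+ 2) (k%:R^-1) ((k%:R ^+ 2)^-1); clear.
  by move=> a b i j; lra.
have S1 : \sum_(1 <= k < X.+1) (k%:R^-1 : R) <= 1 + ln x.
  apply: (le_trans (sum_inv_le R X X0)); rewrite lerD2l ler_ln ?posrE ?ltr0n //; last by lra.
  by have /andP[] := truncn_itv x0.
have S2 := sum_inv_sqr_le R X.
rewrite big_split /= -!mulr_sumr.
have T1 := ler_wpM2l A0 S1; have T2 := ler_wpM2l B0 S2.
rewrite -[x ^+ 3 / _]/B -[x * u * _]/A.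
move: T1 T2; move: (\sum_(_ <= _ < _) _) (\sum_(_ <= _ < _) _) (1 + ln x); clear.
by move=> a b l; lra.
Qed.

(** The fractional part splits into [psi] and 1/2; the half of [sum_mobius_triangle] supplies
    [x^2 / (4 zeta 2)] and the error [x (1 + ln x)]. *)
Lemma C1sum_1 (R : realType) (x u : R) : 1 <= x -> 1 <= u -> x <= u ^+ 2 ->
  `|C1sum 1 x (u ^+ 3) - (u ^+ 3 - x ^+ 2 / (4 * zeta (2 : R)))%:C| <=
  (700 * (x * u * (1 + ln u) * (1 + ln x)) + 3000 * (x ^+ 3 / u ^+ 2)
   + x * (1 + ln x))%:C.
Proof.
move=> x1 u1 xu; have y0 : 0 <= u ^+ 3 by rewrite exprn_ge0 //; lra.
rewrite C1sum_fractional // -rmorphB /= normc_def /= expr0n addr0 sqrtr_sqr lecR.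
have h1 := sum_mobius_psi R x u x1 u1 xu; have h2 := sum_mobius_triangle R x x1.
set X := Num.truncn x in h1 h2 *.
set A := \sum_(1 <= k < _) _ in h1.
set B := \sum_(1 <= k < _) _ in h2.
have -> : \sum_(1 <= k < X.+1) (mobius k)%:~R *
    \sum_(1 <= d < (X %/ k).+1) (d ^ 1)%:R * (psi (u ^+ 3 / (d ^ 1)%:R) + 2^-1) = A + B / 2.
  rewrite /A /B mulr_suml -big_split; apply: eq_bigr => k _ /=.
  rewrite -mulrA -mulrDr mulr_suml -big_split; congr (_ * _); apply: eq_bigr => d _ /=.
  by rewrite expn1 mulrDr.
have -> : u ^+ 3 - (A + B / 2) - (u ^+ 3 - x ^+ 2 / (4 * zeta (2 : R))) =
    - (A + (B - x ^+ 2 / (2 * zeta (2 : R))) / 2).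
  have -> : (4 : R) = 2 * 2 by ring.
  rewrite -mulrA invfM; ring.
rewrite normrN; apply: (le_trans (ler_normD _ _)); apply: lerD => //.
by rewrite normrM (@ger0_norm _ 2^-1) // ler_pdivrMr // (mulrC _ 2) mulrA.
Qed.

(** * Error terms in [x] and [y] *)

(** For [x >= e] the logarithmic factor is at least 1, so [y >= x^(3 b / 2)]; then take the power
    2/3. *)
Lemma cube_root_bounds (R : realType) (b : nat) (x y : R) :
  expR 1 <= x -> x `^ (3 * b%:R / 2) * ln x ^+ 5 <= y ->
  y = (y `^ (1 / 3)) ^+ 3 /\ x ^+ b <= (y `^ (1 / 3)) ^+ 2.
Proof.
move=> xe hy; have e1 : 1 <= expR (1 : R) by have := expR_ge1Dx (1 : R); lra.
have x1 : 1 <= x by apply: le_trans xe.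
have x0 : 0 <= x by lra.
have lx : 1 <= ln x by rewrite -[leLHS]expRK ler_ln // posrE ?expR_gt0 //; lra.
have xy : x `^ (3 * b%:R / 2) <= y.
  by apply: le_trans hy; rewrite ler_peMr ?powR_ge0 // exprn_ege1.
have y0 : 0 <= y by apply: le_trans xy; exact: powR_ge0.
split; first by rewrite -powR_mulrn ?powR_ge0 // -powRrM div1r mulVf ?powRr1.
apply: (@le_trans _ _ (((x `^ (3 * b%:R / 2)) `^ (1 / 3)) ^+ 2)).
  rewrite -powRrM -[X in _ <= X]powR_mulrn ?powR_ge0 // -powRrM.
  rewrite (_ : _ * 2%:R = b%:R); first by rewrite powR_mulrn.
  by field.
rewrite lerXn2r ?nnegrE ?powR_ge0 //.
by apply: ge0_ler_powR => //; rewrite nnegrE ?powR_ge0.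
Qed.

(** Here [x^2 <= x^b <= y^(2/3)], so [x <= y^(1/3)] and [C1sum_trivial] is good enough. The second
    conclusion serves to absorb the term of order [x^3] when [b = 2]. *)
Lemma C1sum_ge2 (R : realType) (b : nat) (x y : R) : (2 <= b)%N ->
  expR 1 <= x -> x `^ (3 * b%:R / 2) * ln x ^+ 5 <= y ->
  `|C1sum b x y - y%:C| <= (2 * (x ^+ b * y `^ (1 / 3) * ln y ^+ 4))%:C /\
  x ^+ b.+1 <= x ^+ b * y `^ (1 / 3) * ln y ^+ 4.
Proof.
move=> b2 xe hy; have [yE hx] := cube_root_bounds R b x y xe hy.
have e1 : 1 <= expR (1 : R) by have := expR_ge1Dx (1 : R); lra.
have x1 : 1 <= x by apply: le_trans xe.
have x0 : 0 <= x by lra.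
set u := y `^ (1 / 3) in yE hx *.
have u0 : 0 <= u by exact: powR_ge0.
have xu : x <= u.
  rewrite -(@ler_pXn2r _ 2) // ?nnegrE //; apply: le_trans hx.
  by rewrite ler_weXn2l.
have lx : 1 <= ln x by rewrite -[leLHS]expRK ler_ln // posrE ?expR_gt0 //; lra.
have ly : 1 <= ln y.
  apply: (le_trans lx); rewrite ler_ln ?posrE ?yE ?exprn_gt0 //; try lra.
  by apply: (le_trans xu); rewrite -[leLHS]expr1 ler_weXn2l //; lra.
have key : x ^+ b.+1 <= x ^+ b * u * ln y ^+ 4.
  rewrite exprSr -[leLHS]mulr1 ler_pM ?mulr_ge0 ?exprn_ge0 ?ler_wpM2l ?exprn_ege1 //.
  by rewrite exprn_ge0.
split=> //; have y0 : 0 <= y by rewrite yE exprn_ge0.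
apply: le_trans (C1sum_trivial R b x y _ x1 y0) _; first exact: ltnW.
by rewrite lecR ler_wpM2l.
Qed.

Theorem theorem1p2 (R : realType) :
  (forall b : nat, b = 1%N \/ b = 2%N ->
     exists K x0 : R, forall x y : R,
       x0 <= x -> x `^ (3 * b%:R / 2) * ln x ^+ 5 <= y ->
       `| C1sum b x y
          - (y - x ^+ (1 + b) / (2 * (1 + b)%:R * zeta (1 + b)%:R))%:C |
       <= (K * (x ^+ b * y `^ (1 / 3) * ln y ^+ 4
                + x ^+ (2 * b + 1) * y `^ (- (2 / 3))
                + x ^+ (b + 1) * y `^ (- (1 / 3))))%:C)
  /\
  (forall b : nat, (3 <= b)%N ->
     exists K x0 : R, forall x y : R,
       x0 <= x -> x `^ (3 * b%:R / 2) * ln x ^+ 5 <= y ->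
       `| C1sum b x y - y%:C |
       <= (K * (x ^+ b * y `^ (1 / 3) * ln y ^+ 4))%:C).
Proof.
split=> b; last first.
  move=> b3; exists 2, (expR 1) => x y xe hy.
  by have [|h _] := @C1sum_ge2 R b x y _ xe hy; first exact: ltnW.
case=> ->.
  exists 3000, (expR 1) => x y xe hy.
  have [yE] := cube_root_bounds R 1 x y xe hy; rewrite expr1.
  have e1 : 1 <= expR (1 : R) by have := expR_ge1Dx (1 : R); lra.
  have x1 : 1 <= x by apply: le_trans xe.
  have x0 : 0 < x by lra.
  set u := y `^ (1 / 3) in yE * => xu.
  have u0 : 0 <= u by exact: powR_ge0.
  have u1 : 1 <= u by rewrite -(@ler_pXn2r _ 2) // ?nnegrE // expr1n; lra.
  have u0' : 0 < u by lra.
  have y0 : 0 <= y by rewrite yE exprn_ge0.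
  have -> : y `^ (- (2 / 3)) = (u ^+ 2)^-1.
    rewrite powRN /u -powR_mulrn ?powR_ge0 // -powRrM; congr (_ `^ _)^-1.
    by field.
  have -> : y `^ (- (1 / 3)) = u^-1 by rewrite powRN.
  have lx : 1 <= ln x by rewrite -[leLHS]expRK ler_ln // posrE expR_gt0.
  have lxu : ln x <= 2 * ln u.
    have -> : 2 * ln u = ln (u ^+ 2) by rewrite lnXn // mulr_natl.
    by rewrite ler_ln // posrE exprn_gt0.
  have lyE : ln y = 3 * ln u by rewrite yE lnXn // mulr_natl.
  have := C1sum_1 R x u x1 u1 xu; rewrite -yE (_ : 2 * (1 + 1)%:R = 4) -?natrM //.
  move=> h; apply: (le_trans h); rewrite lecR.
  (* From [1 <= ln x <= 2 c] with [c = ln u], the factors are at most [3 c] and [4 c], while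
     [ln y = 3 c >= 1]. *)
  have hL : (1 + ln u) * (1 + ln x) <= 2 * ln y ^+ 4.
    move: lx lxu lyE; move: (ln x) (ln u) (ln y); clear=> a c l a1 ac ->.
    have h1 : (1 + c) * (1 + a) <= (3 * c) * (4 * c) by apply: ler_pM; lra.
    have h2 : 1 <= (3 * c) ^+ 2 by rewrite exprn_ege1 //; lra.
    have -> : 2 * (3 * c) ^+ 4 = 2 * (3 * c) ^+ 2 * (3 * c) ^+ 2 by ring.
    nra.
  have hx : 1 + ln x <= 2 * ln y ^+ 4.
    apply: le_trans hL; rewrite ler_peMl ?lerDl; lra.
  have xu0 : 0 <= x * u by rewrite mulr_ge0 // ltW.
  have k1 : x * u * (1 + ln u) * (1 + ln x) <= 2 * (x * u * ln y ^+ 4).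
    by rewrite -mulrA (mulrCA 2) ler_wpM2l.
  have k2 : x * (1 + ln x) <= 2 * (x * u * ln y ^+ 4).
    have -> : 2 * (x * u * ln y ^+ 4) = x * (u * (2 * ln y ^+ 4)) by ring.
    rewrite ler_wpM2l ?(ltW x0) //; apply: (le_trans hx).
    by rewrite ler_peMl // mulr_ge0 // exprn_ge0 // lyE; lra.
  have k3 : 0 <= x ^+ 2 / u by rewrite divr_ge0 ?exprn_ge0 // ltW.
  have k4 : 0 <= x * u * ln y ^+ 4 by rewrite mulr_ge0 // exprn_ge0 //; lra.
  (* The first error term needs only [2 * 700 + 2]; 3000 is forced by the bound on [x^3 / u^2]. *)
  have key (p q r a c : R) : p <= 2 * r -> q <= 2 * r -> 0 <= c -> 0 <= r ->
      700 * p + 3000 * a + q <= 3000 * (r + a + c).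
    by clear; lra.
  exact: key k1 k2 k3 k4.
(* For [b = 2] the term [x^3 / z] is itself within the error, at the price of adding the norm of
   [z^-1] to the constant. *)
pose z : R := 2 * (1 + 2)%:R * zeta (1 + 2)%:R.
exists (2 + `|z^-1|), (expR 1) => x y xe hy; rewrite -/z.
have [//|h1 h2] := @C1sum_ge2 R 2 x y _ xe hy.
have e1 : 1 <= expR (1 : R) by have := expR_ge1Dx (1 : R); lra.
have x0 : 0 <= x by lra.
set M := x ^+ 2 * _ * _ in h1 h2 *.
apply: (@le_trans _ _ (((2 + `|z^-1|) * M)%:C)); last first.
  rewrite lecR ler_wpM2l ?addr_ge0 // -addrA lerDl addr_ge0 // mulr_ge0 ?exprn_ge0 ?powR_ge0 //.
have -> : (C1sum 2 x y - (y - x ^+ (1 + 2) / z)%:C) = (C1sum 2 x y - y%:C) + (x ^+ 3 / z)%:C.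
  by rewrite rmorphB /= opprB addrA addrAC.
apply: (le_trans (ler_normD _ _)); rewrite mulrDl rmorphD /=; apply: lerD => //.
rewrite normc_def /= expr0n addr0 sqrtr_sqr lecR normrM mulrC.
by rewrite ler_wpM2l // ger0_norm // exprn_ge0.
Qed.
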